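(* Let $\mathbb{G}_a=\mathrm{Spec}\,A[y]$ be the additive group over $A$. For every $r\ge 0$, the $A$-module $\mathbf{X}^r_{pq}(\mathbb{G}_a)$ of $\{\delta_p,\delta_q\}$-characters of order $r$ of $\mathbb{G}_a$ is free with basis $$\{\phi_p^i\delta_q^j y \;:\; i,j\ge 0,\ 0\le i+j\le r\}.$$ Hence the $A[\phi_p,\delta_q]$-module $\mathbf{X}^\infty_{pq}(\mathbb{G}_a)$ of all $\{\delta_p,\delta_q\}$-characters of $\mathbb{G}_a$ is free of rank one with basis $y$.
   Context: Fix a prime $p\neq 2$. Let $C_p(X,Y)=\frac{X^p+Y^p-(X+Y)^p}{p}\in\mathbb{Z}[X,Y]$. For a ring $S$ and an $S$-algebra $S'$, a $p$-derivation $\delta_p:S\to S'$ is a map with $\delta_p(1)=0$, $\delta_p(x+y)=\delta_p x+\delta_p y+C_p(x,y)$, $\delta_p(xy)=x^p\delta_p y+y^p\delta_p x+p\,\delta_p x\,\delta_p y$; then $\phi_p(x)=x^p+p\,\delta_p x$ is a ring homomorphism. Given such $\delta_p$, a $\delta_p$-derivation $\delta_q:S\to S'$ is a derivation such that $\delta_q\delta_p x=p\,\delta_p\delta_q x+(\delta_q x)^p-x^{p-1}\delta_q x$ for all $x$. A $\{\delta_p,\delta_q\}$-ring is a ring $A$ with a $p$-derivation $\delta_p:A\to A$ and a $\delta_p$-derivation $\delta_q:A\to A$. Throughout $A$ is a fixed $\{\delta_p,\delta_q\}$-ring which is a $p$-adically complete Noetherian integral domain of characteristic zero. A $\{\delta_p,\delta_q\}$-prolongation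 sequence $S^*$ is a sequence of rings $S^n$ ($n\ge0$) with ring homomorphisms $\varphi:S^n\to S^{n+1}$ (making $S^{n+1}$ an $S^n$-algebra), $p$-derivations $\delta_p:S^n\to S^{n+1}$ and $\delta_p$-derivations $\delta_q:S^n\to S^{n+1}$ commuting with $\varphi$. Morphisms are sequences of ring homomorphisms commuting with $\varphi,\delta_p,\delta_q$. $A$ gives the constant sequence $A^n=A$, $\varphi=\mathrm{id}$; a sequence over $A$ is one with a morphism from $A^*$. For a smooth commutative group scheme $G$ over $A$, a $\{\delta_p,\delta_q\}$-character of order $r$ of $G$ is a rule $\psi$ attaching to each prolongation sequence $S^*$ over $A$ consisting of $p$-adically complete rings a group homomorphism $\psi:G(S^0)\to\mathbb{G}_a(S^r)=S^r$, functorially in $S^*$. These form an $A$-module $\mathbf{X}^r_{pq}(G)$; composing with $\varphi:S^r\to S^{r+1}$ gives maps $\mathbf{X}^r_{pq}(G)\to\mathbf{X}^{r+1}_{pq}(G)$, and $\mathbf{X}^\infty_{pq}(G)$ is the direct limit. Composing with $\phi_p,\delta_q:S^r\to S^{r+1}$ makes $\mathbf{X}^\infty_{pq}(G)$ a left module over $A[\phi_p,\delta_q]$, the ring generated by $A$ and symbols $\phi_p,\delta_q$ subject to $\delta_q\phi_p=p\,\phi_p\delta_q$, $\delta_q a-a\delta_q=\delta_q(a)$, $\phi_p a=\phi_p(a)\phi_p$ for $a\in A$. The character $y$ of $\mathbb{G}_a$ is the identity $\mathbb{G}_a(S^0)=S^0$, and $\phi_p^i\delta_q^jy$ is $u\mapsto\phi_p^i\delta_q^j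 u$. *)

(* Defs.v *)
From HB Require Import structures.
From mathcomp Require Import all_boot all_order all_algebra.
From mathcomp Require Import boolp.

Set Implicit Arguments.
Unset Strict Implicit.
Unset Printing Implicit Defensive.

Import GRing.Theory.
Local Open Scope ring_scope.

(* [lmodule] replaces [lmodType], and [quot] replaces [{eq_quot _}]: a        *)
(* character is a family indexed by all prolongation sequences of rings, so   *)
(* the modules of characters live in a universe strictly above the one        *)
(* allowed for the carriers of the MathComp structures.                       *)
Record lmodule (R : pzRingType) := LModule {
  lm_car :> Type;
  lm_zero : lm_car;
  lm_opp : lm_car -> lm_car;
  lm_add : lm_car -> lm_car -> lm_car;
  lm_scale : R -> lm_car -> lm_car;
  lm_addA : associative lm_add;
  lm_addC : commutative lm_add;
  lm_add0 : left_id lm_zero lm_add;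
  lm_addN : left_inverse lm_zero lm_opp lm_add;
  lm_scaleA : forall a b v, lm_scale a (lm_scale b v) = lm_scale (a * b) v;
  lm_scale1 : left_id 1 lm_scale;
  lm_scaleDr : right_distributive lm_scale lm_add;
  lm_scaleDl : forall v a b,
    lm_scale (a + b) v = lm_add (lm_scale a v) (lm_scale b v) }.

Declare Scope lmodule_scope.
Delimit Scope lmodule_scope with LM.
Notation "u + v" := (lm_add u v) : lmodule_scope.
Notation "- u" := (lm_opp u) : lmodule_scope.
Notation "a *: u" := (lm_scale a u) : lmodule_scope.
Arguments lm_zero {R l}.

Definition is_basis (R : pzRingType) (V : lmodule R) (I : finType) (b : I -> V) :=
  forall v : V, exists! c : {ffun I -> R},
    v = \big[@lm_add R V / lm_zero]_(i : I) (c i *: b i)%LM.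

Section LModuleTheory.
Variables (R : pzRingType).
Implicit Types V W : lmodule R.
Local Open Scope lmodule_scope.

Lemma lm_addI V (u v w : V) : u + v = u + w -> v = w.
Proof.
move=> e; rewrite -[v]lm_add0 -[w]lm_add0 -(lm_addN u) -!lm_addA.
by rewrite e.
Qed.

Lemma lm_addr0 V (u : V) : u + lm_zero = u.
Proof. by rewrite lm_addC lm_add0. Qed.

Definition lm_additive V W (f : V -> W) := forall u v, f (u + v) = f u + f v.

Lemma lm_additive0 V W (f : V -> W) : lm_additive f -> f lm_zero = lm_zero.
Proof. by move=> fD; apply: (@lm_addI _ (f lm_zero)); rewrite -fD !lm_addr0. Qed.

Lemma lm_additiveN V W (f : V -> W) u : lm_additive f -> f (- u) = - f u.
Proof.
move=> fD; apply: (@lm_addI _ (f u)); rewrite -fD.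
by rewrite ![_ + - _]lm_addC !lm_addN lm_additive0.
Qed.

End LModuleTheory.

Section Quot.
Variables (T : Type) (E : T -> T -> Prop).

Definition quot := {P : T -> Prop | exists x, P = E x}.
Definition qpi (x : T) : quot := exist _ (E x) (ex_intro _ x erefl).
Definition qrepr (q : quot) : T := projT1 (cid (proj2_sig q)).

Lemma qreprK q : qpi (qrepr q) = q.
Proof.
case: q => P hP; apply: eq_exist => /=.
by rewrite /qrepr; case: cid => x /= ->.
Qed.

Hypotheses (Erefl : forall x, E x x) (Esym : forall x y, E x y -> E y x).
Hypothesis Etrans : forall x y z, E x y -> E y z -> E x z.

Lemma qpiP x y : qpi x = qpi y <-> E x y.
Proof.
split=> [[->] //|Exy]; apply: eq_exist; apply/funext => z.
by apply/propext; split; apply: Etrans => //; apply: Esym.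
Qed.

Lemma qreprP x : E (qrepr (qpi x)) x.
Proof. by apply/qpiP; rewrite qreprK. Qed.

End Quot.

Section DirectLimit.
Variables (R : pzRingType) (V : nat -> lmodule R).
Variable iota : forall n, V n -> V n.+1.
Hypothesis iotaD : forall n, lm_additive (@iota n).
Hypothesis iotaZ : forall n a u, iota (a *: u)%LM = (a *: iota u)%LM :> V n.+1.
Local Open Scope lmodule_scope.

(* The composite [iota \o ... \o iota : V m -> V n] when [m <= n]; the value   *)
(* [0] for [m > n] is never used.                                              *)
Fixpoint trans (m n : nat) : V m -> V n :=
  match eq_comparable m n with
  | left e => fun u => ecast k (V k) e u
  | right _ => match n return V m -> V n with
               | 0 => fun=> lm_zero
               | n'.+1 => fun u => iota (trans n' u)
               end
  end.

Lemma transnn n (u : V n) : trans n u = u.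
Proof.
case: n u => [|n] u /=.
  by case: (eq_comparable 0%N 0%N) => [e|//]; rewrite eq_axiomK.
by case: (eq_comparable n.+1 n.+1) => [e|//]; rewrite eq_axiomK.
Qed.

Lemma transS m n (u : V m) : (m <= n)%N -> trans n.+1 u = iota (trans n u).
Proof.
move=> le_mn /=; case: (eq_comparable m n.+1) => // e.
by exfalso; move: le_mn; rewrite e ltnn.
Qed.

Lemma trans_trans m n k (u : V m) :
  (m <= n <= k)%N -> trans k (trans n u) = trans k u.
Proof.
case/andP=> le_mn; elim: k => [|k IH].
  by rewrite leqn0 => /eqP e; subst n; rewrite transnn.
rewrite leq_eqVlt => /predU1P[<-|]; first by rewrite transnn.
rewrite ltnS => le_nk; rewrite !transS ?IH //; exact: leq_trans le_nk.
Qed.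

Lemma trans_mor m n (f : forall n, V n -> V n) (u : V m) :
    (forall n v, f n.+1 (iota v) = iota (f n v)) -> (m <= n)%N ->
  trans n (f m u) = f n (trans n u).
Proof.
move=> fi; elim: n => [|n IH].
  by rewrite leqn0 => /eqP e; subst m; rewrite !transnn.
rewrite leq_eqVlt => /predU1P[e|]; first by subst m; rewrite !transnn.
by rewrite ltnS => le_mn; rewrite !transS // IH // fi.
Qed.

Lemma transD m n (u v : V m) :
  (m <= n)%N -> trans n (u + v) = trans n u + trans n v.
Proof.
elim: n => [|n IH]; first by rewrite leqn0 => /eqP e; subst m; rewrite !transnn.
rewrite leq_eqVlt => /predU1P[e|]; first by subst m; rewrite !transnn.
by rewrite ltnS => le_mn; rewrite !transS // IH // iotaD.
Qed.

Lemma trans_shift m n (f : forall n, V n -> V n.+1) (u : V m) :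
    (forall n v, f n.+1 (iota v) = iota (f n v)) -> (m <= n)%N ->
  trans n.+1 (f m u) = f n (trans n u).
Proof.
move=> fi; elim: n => [|n IH].
  by rewrite leqn0 => /eqP e; subst m; rewrite !transnn.
rewrite leq_eqVlt => /predU1P[e|]; first by subst m; rewrite !transnn.
by rewrite ltnS => le_mn; rewrite (@transS _ n.+1) // IH // -fi -(@transS m n).
Qed.

Definition dl_rel (x y : {n & V n}) := exists N,
  [/\ (tag x <= N)%N, (tag y <= N)%N & trans N (tagged x) = trans N (tagged y)].

Lemma dl_rel_up (x y : {n & V n}) N M : (N <= M)%N -> (tag x <= N)%N -> (tag y <= N)%N ->
  trans N (tagged x) = trans N (tagged y) -> trans M (tagged x) = trans M (tagged y).
Proof.
move=> le_NM xN yN e.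
by rewrite -(@trans_trans _ N) ?xN // e trans_trans ?yN.
Qed.

Lemma dl_refl x : dl_rel x x.
Proof. by exists (tag x). Qed.

Lemma dl_sym x y : dl_rel x y -> dl_rel y x.
Proof. by case=> N [? ? ?]; exists N. Qed.

Lemma dl_trans x y z : dl_rel x y -> dl_rel y z -> dl_rel x z.
Proof.
case=> N [xN yN eN] [M [yM zM eM]]; exists (maxn N M).
have [lN lM] := (leq_maxl N M, leq_maxr N M).
split; [exact: leq_trans lN|exact: leq_trans lM|].
by rewrite (dl_rel_up lN xN yN eN) (dl_rel_up lM yM zM eM).
Qed.

Definition dirlim_car := quot dl_rel.
Definition dl_in n (u : V n) : dirlim_car := qpi dl_rel (Tagged (fun k => V k) u).

Lemma dl_inP m n (u : V m) (v : V n) : dl_in u = dl_in v <->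
  exists N, [/\ (m <= N)%N, (n <= N)%N & trans N u = trans N v].
Proof. exact: (qpiP dl_refl dl_sym dl_trans). Qed.

Lemma dl_in_trans n N (u : V n) : (n <= N)%N -> dl_in (trans N u) = dl_in u.
Proof. by move=> nN; apply/dl_inP; exists N; rewrite transnn. Qed.

Lemma dl_in_iota n (u : V n) : dl_in (iota u) = dl_in u.
Proof. by rewrite -(@dl_in_trans n n.+1) // transS // transnn. Qed.

Lemma dl_repr x : dl_in (tagged (qrepr x)) = x.
Proof. by rewrite /dl_in -[RHS]qreprK; case: (qrepr x). Qed.

Lemma dl_surj x : exists n (u : V n), x = dl_in u.
Proof. by exists (tag (qrepr x)), (tagged (qrepr x)); rewrite dl_repr. Qed.

Lemma dl_surj_ge x n : exists N (u : V N), (n <= N)%N /\ x = dl_in u.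
Proof.
have [m [u ->]] := dl_surj x; exists (maxn n m), (trans _ u).
by rewrite leq_maxl dl_in_trans // leq_maxr.
Qed.

Lemma dl_surj2 x y : exists n (u v : V n), x = dl_in u /\ y = dl_in v.
Proof.
have [m [u ->]] := dl_surj x; have [n [v [mn ->]]] := dl_surj_ge y m.
by exists n, (trans n u), v; rewrite dl_in_trans.
Qed.

Lemma dl_surj3 x y z :
  exists n (u v w : V n), [/\ x = dl_in u, y = dl_in v & z = dl_in w].
Proof.
have [m [u [v [-> ->]]]] := dl_surj2 x y; have [n [w [mn ->]]] := dl_surj_ge z m.
by exists n, (trans n u), (trans n v), w; rewrite !dl_in_trans.
Qed.

Definition dl_add (x y : dirlim_car) : dirlim_car :=
  let u := qrepr x in let v := qrepr y in let N := maxn (tag u) (tag v) in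
  dl_in (trans N (tagged u) + trans N (tagged v)).

Definition dl_map0 (f : forall n, V n -> V n) (x : dirlim_car) : dirlim_car :=
  dl_in (f _ (tagged (qrepr x))).

Definition dl_map1 (f : forall n, V n -> V n.+1) (x : dirlim_car) : dirlim_car :=
  dl_in (f _ (tagged (qrepr x))).

Lemma dl_addE n (u v : V n) : dl_add (dl_in u) (dl_in v) = dl_in (u + v).
Proof.
rewrite /dl_add; set x := qrepr _; set y := qrepr (dl_in v).
have : dl_in (tagged x) = dl_in u by rewrite dl_repr.
have : dl_in (tagged y) = dl_in v by rewrite dl_repr.
case: x y => [k a] [l b] /= /dl_inP[M [lM nM eM]] /dl_inP[N [kN nN eN]].
have [leM leN] := (leq_maxr N M, leq_maxl N M).
have [lek lel] := (leq_maxl k l, leq_maxr k l).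
have le_klMN : (maxn k l <= maxn N M)%N.
  by rewrite geq_max (leq_trans kN leN) (leq_trans lM leM).
apply/dl_inP; exists (maxn N M); split=> //; first exact: leq_trans leN.
rewrite !transD ?(leq_trans nN leN) // !trans_trans ?lek ?lel //.
congr (_ + _); first exact: (@dl_rel_up (Tagged (fun i => V i) a) (Tagged (fun i => V i) u) N).
exact: (@dl_rel_up (Tagged (fun i => V i) b) (Tagged (fun i => V i) v) M).
Qed.

Lemma dl_map0E (f : forall n, V n -> V n) n (u : V n) : (forall n v, f n.+1 (iota v) = iota (f n v)) ->
  dl_map0 f (dl_in u) = dl_in (f n u).
Proof.
move=> fi; rewrite /dl_map0; set x := qrepr _.
have : dl_in (tagged x) = dl_in u by rewrite dl_repr.
case: x => k a /= /dl_inP[N [kN nN e]].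
by apply/dl_inP; exists N; rewrite !trans_mor // e.
Qed.

Lemma dl_map1E (f : forall n, V n -> V n.+1) n (u : V n) : (forall n v, f n.+1 (iota v) = iota (f n v)) ->
  dl_map1 f (dl_in u) = dl_in (f n u).
Proof.
move=> fi; rewrite /dl_map1; set x := qrepr _.
have : dl_in (tagged x) = dl_in u by rewrite dl_repr.
case: x => k a /= /dl_inP[N [kN nN e]].
by apply/dl_inP; exists N.+1; rewrite !ltnS !trans_shift // e.
Qed.

Definition dl_zero : dirlim_car := dl_in (lm_zero : V 0).
Definition dl_opp := dl_map0 (fun n => @lm_opp R (V n)).
Definition dl_scale a := dl_map0 (fun n => @lm_scale R (V n) a).

Lemma dl_oppE n (u : V n) : dl_opp (dl_in u) = dl_in (- u).
Proof. by apply: dl_map0E => k v; rewrite lm_additiveN. Qed.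

Lemma dl_scaleE a n (u : V n) : dl_scale a (dl_in u) = dl_in (a *: u).
Proof. by apply: dl_map0E => k v; rewrite iotaZ. Qed.

Lemma dl_zeroE n : dl_zero = dl_in (lm_zero : V n).
Proof. by elim: n => // n ->; rewrite -dl_in_iota lm_additive0. Qed.

Lemma dl_addA : associative dl_add.
Proof.
move=> x y z; have [n [u [v [w [-> -> ->]]]]] := dl_surj3 x y z.
by rewrite !dl_addE lm_addA.
Qed.

Lemma dl_addC : commutative dl_add.
Proof.
by move=> x y; have [n [u [v [-> ->]]]] := dl_surj2 x y; rewrite !dl_addE lm_addC.
Qed.

Lemma dl_add0 : left_id dl_zero dl_add.
Proof.
by move=> x; have [n [u ->]] := dl_surj x; rewrite (dl_zeroE n) dl_addE lm_add0.
Qed.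

Lemma dl_addN : left_inverse dl_zero dl_opp dl_add.
Proof.
move=> x; have [n [u ->]] := dl_surj x.
by rewrite (dl_zeroE n) dl_oppE dl_addE lm_addN.
Qed.

Lemma dl_scaleA a b x : dl_scale a (dl_scale b x) = dl_scale (a * b)%R x.
Proof. by have [n [u ->]] := dl_surj x; rewrite !dl_scaleE lm_scaleA. Qed.

Lemma dl_scale1 : left_id 1%R dl_scale.
Proof. by move=> x; have [n [u ->]] := dl_surj x; rewrite !dl_scaleE lm_scale1. Qed.

Lemma dl_scaleDr : right_distributive dl_scale dl_add.
Proof.
move=> a x y; have [n [u [v [-> ->]]]] := dl_surj2 x y.
by rewrite !(dl_scaleE, dl_addE) lm_scaleDr.
Qed.

Lemma dl_scaleDl x a b :
  dl_scale (a + b)%R x = dl_add (dl_scale a x) (dl_scale b x).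
Proof.
by have [n [u ->]] := dl_surj x; rewrite !(dl_scaleE, dl_addE) lm_scaleDl.
Qed.

Definition dirlim : lmodule R :=
  LModule dl_addA dl_addC dl_add0 dl_addN dl_scaleA dl_scale1 dl_scaleDr dl_scaleDl.

Lemma dl_map1D (f : forall n, V n -> V n.+1) : (forall n v, f n.+1 (iota v) = iota (f n v)) ->
  (forall n, lm_additive (f n)) -> lm_additive (dl_map1 f : dirlim -> dirlim).
Proof.
move=> fi fD x y; have [n [u [v [-> ->]]]] := dl_surj2 x y => /=.
by rewrite dl_addE !dl_map1E // dl_addE fD.
Qed.

End DirectLimit.

(* The polynomial C_p evaluated at (x, y): since p is prime, p divides         *)
(* 'C(p, k) for 0 < k < p, and by the binomial formula                         *)
(* (X^p + Y^p - (X + Y)^p) / p = - \sum_(0 < k < p) ('C(p, k) / p) X^(p-k) Y^k.*)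
Definition Cp (p : nat) (S : comPzRingType) (x y : S) : S :=
  - \sum_(1 <= k < p) x ^+ (p - k) * y ^+ k *+ ('C(p, k) %/ p).

Lemma CpE (p : nat) (S : comPzRingType) (x y : S) : prime p ->
  p%:R * Cp p x y = x ^+ p + y ^+ p - (x + y) ^+ p.
Proof.
move=> p_pr; rewrite /Cp mulrN exprDn -(big_mkord predT (fun i => x ^+ (p - i) * y ^+ i *+ 'C(p, i))).
rewrite big_nat_recr // big_ltn ?prime_gt0 //= subn0 subnn bin0 binn !expr0.
rewrite mulr1 mul1r !mulr1n mulr_sumr.
set t := \sum_(1 <= i < p) _; set u := \sum_(1 <= i < p) _.
have -> : t = u.
  apply: eq_big_nat => i /andP[i0 ip].
  by rewrite mulr_natl -mulrnA divnK // prime_dvd_bin // i0.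
by rewrite -addrA [u + _]addrC addrA opprD addrA subrr add0r.
Qed.

Section Derivations.
Variable p : nat.

Definition is_p_derivation (S S1 : comPzRingType) (f dp : S -> S1) : Prop :=
  [/\ dp 1 = 0,
      forall x y, dp (x + y) = dp x + dp y + Cp p (f x) (f y) &
      forall x y, dp (x * y) =
        f x ^+ p * dp y + f y ^+ p * dp x + p%:R * (dp x * dp y)].

Definition is_derivation (S S1 : comPzRingType) (f dq : S -> S1) : Prop :=
  (forall x y, dq (x + y) = dq x + dq y) /\
  (forall x y, dq (x * y) = f x * dq y + f y * dq x).

(* [f], [dp], [dq] map S to S1, and [f1], [dp1], [dq1] map S1 to S2; the       *)
(* identity lives in S2.                                                       *)
Definition is_dp_derivation (S S1 S2 : comPzRingType) (f dp dq : S -> S1)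
    (f1 dp1 dq1 : S1 -> S2) : Prop :=
  is_derivation f dq /\
  forall x, dq1 (dp x) =
    p%:R * dp1 (dq x) + f1 (dq x) ^+ p - f1 (f x) ^+ p.-1 * f1 (dq x).

Definition phip (S S1 : comPzRingType) (f dp : S -> S1) (x : S) : S1 :=
  f x ^+ p + p%:R * dp x.

Lemma derivationX (S S1 : comPzRingType) (f : {rmorphism S -> S1}) (dq : S -> S1) x n :
  is_derivation f dq -> dq (x ^+ n) = n%:R * f x ^+ n.-1 * dq x.
Proof.
case=> dqD dqM; elim: n => [|n IH].
  have /eqP := dqM 1 1; rewrite mul1r rmorph1 mul1r addrC -subr_eq subrr.
  by rewrite mul0r mul0r => /eqP.
rewrite exprS dqM IH rmorphXn /= mulrS mulrDl mul1r mulrDl addrC; congr (_ + _).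
by case: n {IH} => [|n]; rewrite ?mul0r ?mulr0 // exprS !mulrA [f x * _]mulrC.
Qed.

Lemma derivation_natl (S S1 : comPzRingType) (f dq : S -> S1) x n :
  is_derivation f dq -> dq (n%:R * x) = n%:R * dq x.
Proof.
case=> dqD _; rewrite !mulr_natl.
have dq0 : dq 0 = 0.
  by have /eqP := dqD 0 0; rewrite addr0 -subr_eq subrr => /eqP.
by elim: n => [|n IH]; rewrite ?mulr0n // !mulrS dqD IH.
Qed.

Lemma phipD (S S1 : comPzRingType) (f : {rmorphism S -> S1}) (dp : S -> S1) :
  prime p -> is_p_derivation f dp -> {morph phip f dp : x y / x + y}.
Proof.
move=> p_pr [_ dpD _] x y; rewrite /phip dpD rmorphD !mulrDr CpE //=.
by rewrite addrC addrA subrK addrC addrACA.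
Qed.

Lemma phipM (S S1 : comPzRingType) (f : {rmorphism S -> S1}) (dp : S -> S1) :
  is_p_derivation f dp -> {morph phip f dp : x y / x * y}.
Proof.
move=> [_ _ dpM] x y; rewrite /phip dpM rmorphM exprMn_comm; last exact: mulrC.
rewrite mulrDl !mulrDr !addrA; congr (_ + _ + _ + _).
- by rewrite mulrCA.
- by rewrite [f y ^+ p * _]mulrC mulrA.
- by rewrite -mulrA; congr (_ * _); rewrite mulrCA.
Qed.

End Derivations.

Record pq_structure (p : nat) (A : comPzRingType) := PQStructure {
  pq_dp : A -> A;
  pq_dq : A -> A;
  pq_dpP : is_p_derivation p idfun pq_dp;
  pq_dqP : is_dp_derivation p idfun pq_dp pq_dq idfun pq_dp pq_dq }.

Record prolseq (p : nat) := ProlSeq {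
  ps_ring :> nat -> comPzRingType;
  ps_phi : forall n, {rmorphism ps_ring n -> ps_ring n.+1};
  ps_dp : forall n, ps_ring n -> ps_ring n.+1;
  ps_dq : forall n, ps_ring n -> ps_ring n.+1;
  ps_dpP : forall n, is_p_derivation p (ps_phi n) (@ps_dp n);
  ps_dqP : forall n,
    is_dp_derivation p (ps_phi n) (@ps_dp n) (@ps_dq n)
                     (ps_phi n.+1) (@ps_dp n.+1) (@ps_dq n.+1);
  ps_dp_phi : forall n x, ps_dp (ps_phi n x) = ps_phi n.+1 (ps_dp x);
  ps_dq_phi : forall n x, ps_dq (ps_phi n x) = ps_phi n.+1 (ps_dq x) }.
Arguments ps_phi {p _ n}.
Arguments ps_dp {p _ n}.
Arguments ps_dq {p _ n}.

Record ps_mor (p : nat) (S T : prolseq p) := PSMor {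
  psm :> forall n, {rmorphism S n -> T n};
  psm_phi : forall n x, psm n.+1 (ps_phi x) = ps_phi (psm n x);
  psm_dp : forall n x, psm n.+1 (ps_dp x) = ps_dp (psm n x);
  psm_dq : forall n x, psm n.+1 (ps_dq x) = ps_dq (psm n x) }.

Definition const_prolseq (p : nat) (A : comPzRingType) (D : pq_structure p A) :
    prolseq p :=
  @ProlSeq p (fun=> A) (fun=> idfun) (fun=> pq_dp D) (fun=> pq_dq D)
    (fun=> pq_dpP D) (fun=> pq_dqP D) (fun _ _ => erefl) (fun _ _ => erefl).

Record prolseq_over (p : nat) (A : comPzRingType) (D : pq_structure p A) :=
  ProlSeqOver {
    po_seq :> prolseq p;
    po_str : ps_mor (const_prolseq D) po_seq }.

Record ps_mor_over (p : nat) (A : comPzRingType) (D : pq_structure p A)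
    (S T : prolseq_over D) := PSMorOver {
  pmo :> ps_mor S T;
  pmo_str : forall n (a : A), pmo n (po_str S n a) = po_str T n a }.

(* The two conditions are injectivity and surjectivity of S -> lim_n S / p^n S. *)
Definition padic_complete (p : nat) (S : comPzRingType) : Prop :=
  (forall x : S, (forall n, exists y, x = p%:R ^+ n * y) -> x = 0) /\
  (forall u : nat -> S, (forall n, exists y, u n.+1 - u n = p%:R ^+ n * y) ->
     exists x, forall n, exists y, x - u n = p%:R ^+ n * y).

Definition noetherian (S : comPzRingType) : Prop :=
  forall I : S -> Prop,
    I 0 -> (forall x y, I x -> I y -> I (x + y)) -> (forall a x, I x -> I (a * x)) ->
  exists s : seq S, forall x,
    I x <-> exists c : nat -> S, x = \sum_(i < size s) c i * s`_i.

Definition ps_complete (p : nat) (S : prolseq p) : Prop :=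
  forall n, padic_complete p (S n).

Section Characters.
Variables (p : nat) (p_pr : prime p) (A : comPzRingType) (D : pq_structure p A).

(* Characters of order r of G_a, with G_a(S) the additive group of S.          *)
Record character (r : nat) := Character {
  ch_fun :> forall S : prolseq_over D, ps_complete S -> S 0%N -> S r;
  ch_add : forall S hS, {morph @ch_fun S hS : u v / u + v};
  ch_nat : forall (S T : prolseq_over D) hS hT (g : ps_mor_over S T) u,
    g r (@ch_fun S hS u) = @ch_fun T hT (g 0%N u) }.
Arguments ch_fun {r} _ S hS _.
Arguments ch_add {r} _ S hS _ _.
Arguments ch_nat {r} _ {S T} hS hT g u.

Lemma character_eq r (f g : character r) :
  (forall S hS u, f S hS u = g S hS u) -> f = g.
Proof.
case: f g => [f fD fN] [g gD gN] /= fg.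
have {fg} E : f = g.
  apply: functional_extensionality_dep => S; apply: functional_extensionality_dep => hS.
  exact: functional_extensionality_dep (fg S hS).
by subst g; congr Character; exact: Prop_irrelevance.
Qed.

Local Obligation Tactic := idtac.

Program Definition ch_zero r : character r :=
  @Character r (fun S hS u => 0) _ _.
Next Obligation. by move=> r S hS u v; rewrite addr0. Qed.
Next Obligation. by move=> r S T hS hT g u; rewrite rmorph0. Qed.

Program Definition ch_opp r (f : character r) : character r :=
  @Character r (fun S hS u => - f S hS u) _ _.
Next Obligation. by move=> r f S hS u v; rewrite ch_add opprD. Qed.
Next Obligation. by move=> r f S T hS hT g u; rewrite rmorphN (ch_nat f hS hT). Qed.

Program Definition ch_plus r (f g : character r) : character r :=
  @Character r (fun S hS u => f S hS u + g S hS u) _ _.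
Next Obligation. by move=> r f g S hS u v; rewrite !ch_add addrACA. Qed.
Next Obligation.
by move=> r f g S T hS hT m u; rewrite rmorphD (ch_nat f hS hT) (ch_nat g hS hT).
Qed.

Program Definition ch_scale r (a : A) (f : character r) : character r :=
  @Character r (fun S hS u => po_str S r a * f S hS u) _ _.
Next Obligation. by move=> r a f S hS u v; rewrite ch_add mulrDr. Qed.
Next Obligation.
by move=> r a f S T hS hT m u; rewrite rmorphM pmo_str (ch_nat f hS hT).
Qed.

Program Definition ch_up r (f : character r) : character r.+1 :=
  @Character r.+1 (fun S hS u => ps_phi (f S hS u)) _ _.
Next Obligation. by move=> r f S hS u v; rewrite ch_add rmorphD. Qed.
Next Obligation.
by move=> r f S T hS hT m u; rewrite psm_phi (ch_nat f hS hT).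
Qed.

Program Definition ch_phip r (f : character r) : character r.+1 :=
  @Character r.+1 (fun S hS u => phip p ps_phi ps_dp (f S hS u)) _ _.
Next Obligation.
by move=> r f S hS u v; rewrite ch_add (phipD p_pr (ps_dpP S r)).
Qed.
Next Obligation.
move=> r f S T hS hT m u; rewrite /phip rmorphD rmorphM rmorphXn rmorph_nat /=.
by rewrite psm_phi psm_dp (ch_nat f hS hT).
Qed.

Program Definition ch_dq r (f : character r) : character r.+1 :=
  @Character r.+1 (fun S hS u => ps_dq (f S hS u)) _ _.
Next Obligation.
by move=> r f S hS u v; rewrite ch_add; case: (ps_dqP S r) => [[-> _] _].
Qed.
Next Obligation.
by move=> r f S T hS hT m u; rewrite psm_dq (ch_nat f hS hT).
Qed.

Program Definition ch_y : character 0 := @Character 0 (fun S hS u => u) _ _.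
Next Obligation. by []. Qed.
Next Obligation. by []. Qed.

Program Definition Xr (r : nat) : lmodule A :=
  @LModule A (character r) (@ch_zero r) (@ch_opp r) (@ch_plus r) (@ch_scale r)
    _ _ _ _ _ _ _ _.
Next Obligation. by move=> r f g h; apply: character_eq => S hS u /=; rewrite addrA. Qed.
Next Obligation. by move=> r f g; apply: character_eq => S hS u /=; rewrite addrC. Qed.
Next Obligation. by move=> r f; apply: character_eq => S hS u /=; rewrite add0r. Qed.
Next Obligation. by move=> r f; apply: character_eq => S hS u /=; rewrite addNr. Qed.
Next Obligation.
by move=> r a b f; apply: character_eq => S hS u /=; rewrite rmorphM mulrA.
Qed.
Next Obligation.
by move=> r f; apply: character_eq => S hS u /=; rewrite rmorph1 mul1r.
Qed.
Next Obligation.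
by move=> r a f g; apply: character_eq => S hS u /=; rewrite mulrDr.
Qed.
Next Obligation.
by move=> r f a b; apply: character_eq => S hS u /=; rewrite rmorphD mulrDl.
Qed.

Fixpoint dq_iter (j : nat) : character j :=
  if j is j'.+1 then ch_dq (dq_iter j') else ch_y.

Fixpoint phi_dq_iter (i j : nat) : character (i + j) :=
  if i is i'.+1 then ch_phip (phi_dq_iter i' j) else dq_iter j.

Lemma ch_upD r : lm_additive (@ch_up r : Xr r -> Xr r.+1).
Proof. by move=> f g; apply: character_eq => S hS u /=; rewrite rmorphD. Qed.

Lemma ch_upZ r a (f : Xr r) :
  ch_up (a *: f)%LM = (a *: (ch_up f : Xr r.+1))%LM :> Xr r.+1.
Proof. by apply: character_eq => S hS u /=; rewrite rmorphM /= psm_phi. Qed.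

(* phi_p^i delta_q^j y as a character of order r; meaningful for i + j <= r.  *)
Definition phi_dq_y (r i j : nat) : Xr r :=
  trans (V := Xr) ch_up r (phi_dq_iter i j : Xr (i + j)).

End Characters.

Section OperatorRing.
Variables (p : nat) (A : comPzRingType) (D : pq_structure p A).

Inductive pqterm : Type :=
| TConst of A
| TPhi
| TDelta
| TOpp of pqterm
| TAdd of pqterm & pqterm
| TMul of pqterm & pqterm.

Inductive pqeq : pqterm -> pqterm -> Prop :=
| pqeq_refl s : pqeq s s
| pqeq_sym s t : pqeq s t -> pqeq t s
| pqeq_trans s t u : pqeq s t -> pqeq t u -> pqeq s u
| pqeq_opp s s' : pqeq s s' -> pqeq (TOpp s) (TOpp s')
| pqeq_add s s' t t' : pqeq s s' -> pqeq t t' -> pqeq (TAdd s t) (TAdd s' t')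
| pqeq_mul s s' t t' : pqeq s s' -> pqeq t t' -> pqeq (TMul s t) (TMul s' t')
| pqeq_addA s t u : pqeq (TAdd s (TAdd t u)) (TAdd (TAdd s t) u)
| pqeq_addC s t : pqeq (TAdd s t) (TAdd t s)
| pqeq_add0 s : pqeq (TAdd (TConst 0) s) s
| pqeq_addN s : pqeq (TAdd (TOpp s) s) (TConst 0)
| pqeq_mulA s t u : pqeq (TMul s (TMul t u)) (TMul (TMul s t) u)
| pqeq_mul1l s : pqeq (TMul (TConst 1) s) s
| pqeq_mul1r s : pqeq (TMul s (TConst 1)) s
| pqeq_mulDl s t u : pqeq (TMul (TAdd s t) u) (TAdd (TMul s u) (TMul t u))
| pqeq_mulDr s t u : pqeq (TMul s (TAdd t u)) (TAdd (TMul s t) (TMul s u))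
| pqeq_constD a b : pqeq (TConst (a + b)) (TAdd (TConst a) (TConst b))
| pqeq_constM a b : pqeq (TConst (a * b)) (TMul (TConst a) (TConst b))
| pqeq_delta_phi :
    pqeq (TMul TDelta TPhi) (TMul (TConst p%:R) (TMul TPhi TDelta))
| pqeq_delta a :
    pqeq (TAdd (TMul TDelta (TConst a)) (TOpp (TMul (TConst a) TDelta)))
         (TConst (pq_dq D a))
| pqeq_phi a :
    pqeq (TMul TPhi (TConst a)) (TMul (TConst (phip p idfun (pq_dp D) a)) TPhi).

HB.instance Definition _ := gen_eqMixin pqterm.
HB.instance Definition _ := gen_choiceMixin pqterm.

Definition pqeqb (s t : pqterm) : bool := `[< pqeq s t >].

Fact pqeqb_equiv : equiv_class_of pqeqb.
Proof.
split=> [s|s t|t s u].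
- by apply/asboolP/pqeq_refl.
- by apply/asboolP/asboolP; exact: pqeq_sym.
- move=> /asboolP st /asboolP tu; apply/asboolP; exact: pqeq_trans tu.
Qed.

Canonical pqeqb_rel := EquivRelPack pqeqb_equiv.

(* A[phi_p, delta_q] *)
Definition pqring := {eq_quot pqeqb_rel}%qT.
HB.instance Definition _ := Choice.on pqring.

Definition pqpi (t : pqterm) : pqring := \pi_pqring%qT t.
Definition pqrepr (x : pqring) : pqterm := repr x.

Lemma pqpiP s t : pqpi s = pqpi t <-> pqeq s t.
Proof.
split=> [/(@eqmodP _ pqeqb_rel)/asboolP //|st].
by apply/(@eqmodP _ pqeqb_rel)/asboolP.
Qed.

Lemma pqreprK x : pqpi (pqrepr x) = x.
Proof. exact: reprK. Qed.

Lemma pqreprP t : pqeq (pqrepr (pqpi t)) t.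
Proof. by apply/pqpiP; rewrite pqreprK. Qed.

Lemma pqring_ind (P : pqring -> Prop) : (forall t, P (pqpi t)) -> forall x, P x.
Proof. by move=> H x; rewrite -[x]pqreprK. Qed.

Definition pq_opp (x : pqring) := pqpi (TOpp (pqrepr x)).
Definition pq_add (x y : pqring) := pqpi (TAdd (pqrepr x) (pqrepr y)).
Definition pq_mul (x y : pqring) := pqpi (TMul (pqrepr x) (pqrepr y)).

Lemma pq_oppE s : pq_opp (pqpi s) = pqpi (TOpp s).
Proof. by apply/pqpiP/pqeq_opp/pqreprP. Qed.

Lemma pq_addE s t : pq_add (pqpi s) (pqpi t) = pqpi (TAdd s t).
Proof. by apply/pqpiP/pqeq_add; exact: pqreprP. Qed.

Lemma pq_mulE s t : pq_mul (pqpi s) (pqpi t) = pqpi (TMul s t).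
Proof. by apply/pqpiP/pqeq_mul; exact: pqreprP. Qed.

Let E := (pq_addE, pq_mulE, pq_oppE).

Fact pq_addA : associative pq_add.
Proof.
elim/pqring_ind=> s; elim/pqring_ind=> t; elim/pqring_ind=> u.
by rewrite !E; apply/pqpiP/pqeq_addA.
Qed.

Fact pq_addC : commutative pq_add.
Proof.
by elim/pqring_ind=> s; elim/pqring_ind=> t; rewrite !E; apply/pqpiP/pqeq_addC.
Qed.

Fact pq_add0 : left_id (pqpi (TConst 0)) pq_add.
Proof. by elim/pqring_ind=> s; rewrite E; apply/pqpiP/pqeq_add0. Qed.

Fact pq_addN : left_inverse (pqpi (TConst 0)) pq_opp pq_add.
Proof. by elim/pqring_ind=> s; rewrite !E; apply/pqpiP/pqeq_addN. Qed.

Fact pq_mulA : associative pq_mul.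
Proof.
elim/pqring_ind=> s; elim/pqring_ind=> t; elim/pqring_ind=> u.
by rewrite !E; apply/pqpiP/pqeq_mulA.
Qed.

Fact pq_mul1l : left_id (pqpi (TConst 1)) pq_mul.
Proof. by elim/pqring_ind=> s; rewrite E; apply/pqpiP/pqeq_mul1l. Qed.

Fact pq_mul1r : right_id (pqpi (TConst 1)) pq_mul.
Proof. by elim/pqring_ind=> s; rewrite E; apply/pqpiP/pqeq_mul1r. Qed.

Fact pq_mulDl : left_distributive pq_mul pq_add.
Proof.
elim/pqring_ind=> s; elim/pqring_ind=> t; elim/pqring_ind=> u.
by rewrite !E; apply/pqpiP/pqeq_mulDl.
Qed.

Fact pq_mulDr : right_distributive pq_mul pq_add.
Proof.
elim/pqring_ind=> s; elim/pqring_ind=> t; elim/pqring_ind=> u.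
by rewrite !E; apply/pqpiP/pqeq_mulDr.
Qed.

HB.instance Definition _ := GRing.isZmodule.Build pqring
  pq_addA pq_addC pq_add0 pq_addN.
HB.instance Definition _ := GRing.Zmodule_isPzRing.Build pqring
  pq_mulA pq_mul1l pq_mul1r pq_mulDl pq_mulDr.

Lemma pqpiD s t : pqpi (TAdd s t) = pqpi s + pqpi t.
Proof. by rewrite -pq_addE. Qed.

Lemma pqpiN s : pqpi (TOpp s) = - pqpi s.
Proof. by rewrite -pq_oppE. Qed.

Lemma pqpiM s t : pqpi (TMul s t) = pqpi s * pqpi t.
Proof. by rewrite -pq_mulE. Qed.

Lemma pqpi0 : pqpi (TConst 0) = 0. Proof. by []. Qed.
Lemma pqpi1 : pqpi (TConst 1) = 1. Proof. by []. Qed.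

End OperatorRing.

Section AllCharacters.
Variables (p : nat) (p_pr : prime p) (A : comPzRingType) (D : pq_structure p A).
Local Notation X := (Xr D).

Definition Xlim : lmodule A := dirlim (@ch_upD p A D) (@ch_upZ p A D).

Definition Xlim_in (r : nat) (f : X r) : Xlim := dl_in (V := X) (@ch_up p A D) f.

Definition Xlim_phip : Xlim -> Xlim :=
  dl_map1 (V := X) (iota := @ch_up p A D) (@ch_phip p p_pr A D).
Definition Xlim_dq : Xlim -> Xlim :=
  dl_map1 (V := X) (iota := @ch_up p A D) (@ch_dq p A D).

Lemma ch_phip_up n (f : X n) : ch_phip p_pr (ch_up f) = ch_up (ch_phip p_pr f).
Proof.
apply: character_eq => S hS u /=; rewrite /phip ps_dp_phi.
by rewrite rmorphD rmorphM rmorphXn rmorph_nat.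
Qed.

Lemma ch_dq_up n (f : X n) : ch_dq (ch_up f) = ch_up (ch_dq f).
Proof. by apply: character_eq => S hS u /=; rewrite ps_dq_phi. Qed.

Lemma ch_phip_add n : lm_additive (@ch_phip p p_pr A D n : X n -> X n.+1).
Proof.
by move=> f g; apply: character_eq => S hS u /=; rewrite (phipD p_pr (ps_dpP S n)).
Qed.

Lemma ch_dq_add n : lm_additive (@ch_dq p A D n : X n -> X n.+1).
Proof.
by move=> f g; apply: character_eq => S hS u /=; case: (ps_dqP S n) => [[-> _] _].
Qed.

Lemma Xlim_phipE n (f : X n) :
  Xlim_phip (Xlim_in f) = Xlim_in (ch_phip p_pr f : X n.+1).
Proof. exact: (dl_map1E f ch_phip_up). Qed.

Lemma Xlim_dqE n (f : X n) : Xlim_dq (Xlim_in f) = Xlim_in (ch_dq f : X n.+1).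
Proof. exact: (dl_map1E f ch_dq_up). Qed.

Lemma Xlim_phipD : lm_additive Xlim_phip.
Proof. by apply: dl_map1D; [exact: ch_phip_up | exact: ch_phip_add]. Qed.

Lemma Xlim_dqD : lm_additive Xlim_dq.
Proof. by apply: dl_map1D; [exact: ch_dq_up | exact: ch_dq_add]. Qed.

Lemma Xlim_scaleE a n (f : X n) : (a *: Xlim_in f)%LM = Xlim_in (a *: f)%LM.
Proof. exact: (dl_scaleE (@ch_upZ p A D) a f). Qed.

Lemma Xlim_addE n (f g : X n) : (Xlim_in f + Xlim_in g)%LM = Xlim_in (f + g)%LM.
Proof. exact: (dl_addE (@ch_upD p A D) f g). Qed.

Lemma Xlim_in_up n (f : X n) : Xlim_in (ch_up f : X n.+1) = Xlim_in f.
Proof. exact: (@dl_in_iota _ X (@ch_up p A D)). Qed.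

Lemma Xlim_surj (x : Xlim) : exists n (f : X n), x = Xlim_in f.
Proof. exact: dl_surj. Qed.

Lemma Xlim_dq_phip x : Xlim_dq (Xlim_phip x) = (p%:R *: Xlim_phip (Xlim_dq x))%LM.
Proof.
have [n [f ->]] := Xlim_surj x.
rewrite Xlim_phipE !Xlim_dqE Xlim_phipE Xlim_scaleE; congr Xlim_in.
apply: character_eq => S hS u /=; set v := f S hS u.
have [[dqD dqM] _] := ps_dqP S n.+1; have [_ dqdp] := ps_dqP S n.
rewrite /phip rmorph_nat dqD (derivationX _ _ (conj dqD dqM)).
rewrite (derivation_natl _ _ (conj dqD dqM)) dqdp ps_dq_phi.
rewrite -mulrA -mulrDr; congr (_ * _).
by rewrite addrC subrK addrC.
Qed.

Lemma Xlim_dq_scale a x :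
  Xlim_dq (a *: x)%LM = (a *: Xlim_dq x + pq_dq D a *: x)%LM.
Proof.
have [n [f ->]] := Xlim_surj x.
rewrite Xlim_scaleE !Xlim_dqE -[in X in (_ + X)%LM](Xlim_in_up f) !Xlim_scaleE Xlim_addE.
congr Xlim_in; apply: character_eq => S hS u /=.
case: (ps_dqP S n) => [[_ ->] _]; congr (_ + _).
  by congr (_ * _); exact: esym (psm_phi (po_str S) a).
by rewrite mulrC; congr (_ * _); exact: esym (psm_dq (po_str S) a).
Qed.

Lemma Xlim_phip_scale a x :
  Xlim_phip (a *: x)%LM = (phip p idfun (pq_dp D) a *: Xlim_phip x)%LM.
Proof.
have [n [f ->]] := Xlim_surj x.
rewrite Xlim_scaleE !Xlim_phipE Xlim_scaleE.
congr Xlim_in; apply: character_eq => S hS u /=.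
rewrite (phipM (ps_dpP S n)); congr (_ * _).
rewrite /phip rmorphD rmorphM rmorphXn rmorph_nat /=; congr (_ ^+ _ + _ * _).
  exact: esym (psm_phi (po_str S) a).
exact: esym (psm_dp (po_str S) a).
Qed.

Local Arguments lm_zero : simpl never.
Local Arguments lm_opp : simpl never.
Local Arguments lm_add : simpl never.
Local Arguments lm_scale : simpl never.

Fixpoint pq_act (t : pqterm A) (x : Xlim) : Xlim :=
  match t with
  | TConst a => (a *: x)%LM
  | TPhi => Xlim_phip x
  | TDelta => Xlim_dq x
  | TOpp s => (- pq_act s x)%LM
  | TAdd s s' => (pq_act s x + pq_act s' x)%LM
  | TMul s s' => pq_act s (pq_act s' x)
  end.

Lemma lm_oppD (R : pzRingType) (V : lmodule R) (u v : V) :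
  (- (u + v) = - u + - v)%LM.
Proof.
apply: (@lm_addI _ _ (u + v)%LM); rewrite lm_addC lm_addN.
rewrite lm_addA [(u + v)%LM]lm_addC -[(v + u + - u)%LM]lm_addA.
by rewrite [(u + - u)%LM]lm_addC lm_addN lm_addr0 lm_addC lm_addN.
Qed.

Lemma pq_actD t : lm_additive (pq_act t).
Proof.
elim: t => [a|||s IH|s IHs t IHt|s IHs t IHt] x y /=.
- by rewrite lm_scaleDr.
- exact: Xlim_phipD.
- exact: Xlim_dqD.
- by rewrite IH lm_oppD.
- rewrite IHs IHt -!lm_addA [(pq_act s y + (_ + _))%LM]lm_addC -lm_addA.
  by rewrite [(pq_act t y + pq_act s y)%LM]lm_addC.
- by rewrite IHt IHs.
Qed.

Lemma lm_scale0 (R : pzRingType) (V : lmodule R) (v : V) :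
  (0 *: v)%LM = lm_zero.
Proof. by apply: (@lm_addI _ _ (0 *: v)%LM); rewrite -lm_scaleDl addr0 lm_addr0. Qed.

Lemma pq_act_eq s t : pqeq D s t -> forall x, pq_act s x = pq_act t x.
Proof.
elim=> {s t} /=.
- by [].
- by move=> s t _ IH x; rewrite IH.
- by move=> s t u _ IH1 _ IH2 x; rewrite IH1 IH2.
- by move=> s s' _ IH x; rewrite IH.
- by move=> s s' t t' _ IH1 _ IH2 x; rewrite IH1 IH2.
- by move=> s s' t t' _ IH1 _ IH2 x; rewrite IH1 IH2.
- by move=> *; rewrite lm_addA.
- by move=> *; rewrite lm_addC.
- by move=> *; rewrite lm_scale0 lm_add0.
- by move=> *; rewrite lm_addN lm_scale0.
- by [].
- by move=> *; rewrite lm_scale1.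
- by move=> *; rewrite lm_scale1.
- by [].
- by move=> s t u x; rewrite pq_actD.
- by move=> *; rewrite lm_scaleDl.
- by move=> *; rewrite lm_scaleA.
- exact: Xlim_dq_phip.
- move=> a x; rewrite Xlim_dq_scale [(_ + - _)%LM]lm_addC lm_addA.
  by rewrite lm_addN lm_add0.
- exact: Xlim_phip_scale.
Qed.

Definition pq_scale (P : pqring D) : Xlim -> Xlim := pq_act (pqrepr P).

Lemma pq_scaleE t x : pq_scale (pqpi D t) x = pq_act t x.
Proof. by apply: pq_act_eq; exact: pqreprP. Qed.

Local Obligation Tactic := idtac.

Program Definition Xinf : lmodule (pqring D) :=
  @LModule (pqring D) Xlim lm_zero (@lm_opp A Xlim) (@lm_add A Xlim) pq_scale
    (@lm_addA A Xlim) (@lm_addC A Xlim) (@lm_add0 A Xlim) (@lm_addN A Xlim)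
    _ _ _ _.
Next Obligation.
elim/pqring_ind=> s; elim/pqring_ind=> t x.
by rewrite -pqpiM !pq_scaleE.
Qed.
Next Obligation. by move=> x; rewrite -pqpi1 pq_scaleE /= lm_scale1. Qed.
Next Obligation. by elim/pqring_ind=> s x y; rewrite !pq_scaleE pq_actD. Qed.
Next Obligation.
move=> x; elim/pqring_ind=> s; elim/pqring_ind=> t.
by rewrite -pqpiD !pq_scaleE.
Qed.

Definition Xinf_in (r : nat) (f : X r) : Xinf := Xlim_in f.

Lemma Xinf_constE a r (f : X r) :
  (pqpi D (TConst a) *: Xinf_in f)%LM = Xinf_in (a *: f)%LM.
Proof. by rewrite [LHS]pq_scaleE /= Xlim_scaleE. Qed.

Lemma Xinf_phiE r (f : X r) :
  (pqpi D (TPhi A) *: Xinf_in f)%LM = Xinf_in (ch_phip p_pr f : X r.+1).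
Proof. by rewrite [LHS]pq_scaleE /= Xlim_phipE. Qed.

Lemma Xinf_deltaE r (f : X r) :
  (pqpi D (TDelta A) *: Xinf_in f)%LM = Xinf_in (ch_dq f : X r.+1).
Proof. by rewrite [LHS]pq_scaleE /= Xlim_dqE. Qed.

End AllCharacters.

(* Main.v *)
(* By naturality a character f of order r is determined by its values on the    *)
(* truncations n |-> S n / p^(N - n) of prolongation sequences; these levels    *)
(* are killed by a power of p, hence complete, so that no p-adic completion has *)
(* to be constructed. On the truncations of the universal sequence, polynomials *)
(* in the variables y_ij = delta_p^i delta_q^j y with i + j <= n, the value of  *)
(* f at y is a compatible family of polynomials g_N modulo p^N. Additivity is   *)
(* used only as f (2 y) = 2 f y: the endomorphism y |-> 2 y acts on the forms   *)
(* of degree d as 2^d modulo higher degree, so g_N is determined by its linear  *)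
(* part. Since phi_p^i delta_q^j y = p^i y_ij modulo degree 2, completeness of  *)
(* A makes p^r g_N a linear combination of these elements modulo p^N, with      *)
(* coefficients in A. As phi_p^i delta_q^j y = y_0j^(p^i) modulo p, they are    *)
(* independent modulo p, and the combination can be divided by p^r. Uniqueness  *)
(* is again read off the linear parts. The operators phi_p^i delta_q^j span     *)
(* A[phi_p, delta_q] over A, whence the statement on the direct limit.          *)

Require Import Defs.
From HB Require Import structures.
From mathcomp Require Import all_boot all_order all_algebra.
From mathcomp Require Import boolp finmap ring.
From mathcomp.multinomials Require Import monalg.

Set Implicit Arguments.
Unset Strict Implicit.
Unset Printing Implicit Defensive.

Import GRing.Theory.
Local Open Scope ring_scope.

(** * Divisibility by powers of p *)

(** Naturality makes a character f of order r, modulo p^n, the evaluation of a polynomial g_n of the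
    universal sequence [jseq_over] ([ch_repr_nilpotent], [ch_repr_eval]). The g_n are compatible
    ([ch_repr_cauchy]), and additivity gives g_n(2 y) = 2 g_n modulo p^n ([ch_repr_dbl]). Such a
    family is determined by its linear part: in degree d the substitution y |-> 2 y acts as 2^d up
    to higher degree, and dividing by 2^d - 2, nonzero for d different from 1, costs a bounded power
    of p ([dbl_rigid]). The linear part of phi_p^i delta_q^j y is p^i y_ij ([jz_linear]), so p^r g_n
    is a combination of these generators, its coefficients being limits in A. Modulo p the
    generators are the distinct monomials y_0j^(p^i) ([jform_modp]), so p^r can be divided out
    ([doubling_form]). Separatedness of the levels of S turns the congruences into an equality
    ([ch_form_surj]); linear parts also give independence ([jform_inj]). Normal ordering writes each
    operator as a sum of terms a phi_p^i delta_q^j ([pqform_surj]), whose action on y is the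
    character with the same coefficients ([pqform_y]). Freeness of the direct limit thus reduces to
    finite order. *)

Definition pdvd (p : nat) (S : comPzRingType) (k : nat) (x : S) : Prop :=
  exists y, x = p%:R ^+ k * y.

Section PowerDivisibility.
Variables (p : nat) (S : comPzRingType).
Implicit Types (k l n : nat) (x y z : S).
Local Notation pdvd := (@pdvd p S).

Lemma pdvd0 k : pdvd k 0. Proof. by exists 0; rewrite mulr0. Qed.

Lemma pdvdD k x y : pdvd k x -> pdvd k y -> pdvd k (x + y).
Proof. by case=> u -> [v ->]; exists (u + v); rewrite mulrDr. Qed.

Lemma pdvdN k x : pdvd k x -> pdvd k (- x).
Proof. by case=> u ->; exists (- u); rewrite mulrN. Qed.

Lemma pdvdB k x y : pdvd k x -> pdvd k y -> pdvd k (x - y).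
Proof. by move=> hx /pdvdN; apply: pdvdD. Qed.

Lemma pdvd_subC k x y : pdvd k (x - y) -> pdvd k (y - x).
Proof. by rewrite -(opprB x y) => /pdvdN. Qed.

Lemma pdvd_subtrans k y x z : pdvd k (x - y) -> pdvd k (y - z) -> pdvd k (x - z).
Proof. by move=> h1 h2; rewrite -(subrKA y); apply: pdvdD. Qed.

Lemma pdvdMr k x y : pdvd k x -> pdvd k (x * y).
Proof. by case=> u ->; exists (u * y); rewrite mulrA. Qed.

Lemma pdvdMl k x y : pdvd k y -> pdvd k (x * y).
Proof. by rewrite mulrC; apply: pdvdMr. Qed.

Lemma pdvdMn k x n : pdvd k x -> pdvd k (x *+ n).
Proof. by case=> u ->; exists (u *+ n); rewrite mulrnAr. Qed.

Lemma pdvdE k x : pdvd k (p%:R ^+ k * x). Proof. by exists x. Qed.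

Lemma pdvd_le k l x : (k <= l)%N -> pdvd l x -> pdvd k x.
Proof.
by move=> kl [u ->]; rewrite -(subnKC kl) exprD -mulrA; apply: pdvdE.
Qed.

Lemma pdvd_zero x : pdvd 0 x. Proof. by exists x; rewrite mul1r. Qed.

Lemma pdvdM k l x y : pdvd k x -> pdvd l y -> pdvd (k + l) (x * y).
Proof. by case=> u -> [v ->]; exists (u * v); rewrite exprD mulrACA. Qed.

Lemma pdvd_sum k (I : Type) (r : seq I) (P : pred I) (F : I -> S) :
  (forall i, P i -> pdvd k (F i)) -> pdvd k (\sum_(i <- r | P i) F i).
Proof.
move=> hF; elim/big_rec: _ => [|i x Pi]; first exact: pdvd0.
by apply: pdvdD; exact: hF.
Qed.

Lemma pdvd_subM k x x' y y' :
  pdvd k (x - x') -> pdvd k (y - y') -> pdvd k (x * y - x' * y').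
Proof.
move=> hx hy; rewrite -(subrKA (x' * y)) -mulrBl -mulrBr.
by apply: pdvdD; [apply: pdvdMr | apply: pdvdMl].
Qed.

Lemma pdvd_subX k x y n : pdvd k (x - y) -> pdvd k (x ^+ n - y ^+ n).
Proof. by move=> h; rewrite subrXX; apply: pdvdMr. Qed.

Lemma pdvdX n k x : (0 < n)%N -> pdvd k x -> pdvd k (x ^+ n).
Proof. by case: n => // n _ h; rewrite exprS; apply: pdvdMr. Qed.

Lemma pdvd_cancel m n x : (forall y z, p%:R * y = p%:R * z -> y = z) ->
  pdvd (m + n) (p%:R ^+ m * x) -> pdvd n x.
Proof.
move=> pI; elim: m => [|m IH]; first by rewrite mul1r.
by case=> y; rewrite exprS -mulrA addSn exprS -mulrA => /pI e; apply: IH; exists y.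
Qed.

Lemma pdvd_cauchy (u : nat -> S) m n : (forall n, pdvd n (u n.+1 - u n)) ->
  pdvd n (u (n + m)%N - u n).
Proof.
move=> hu; elim: m => [|m IH]; first by rewrite addn0 subrr; apply: pdvd0.
rewrite addnS -(subrKA (u (n + m)%N)); apply: pdvdD IH.
by apply: (pdvd_le (leq_addr m n)); apply: hu.
Qed.

End PowerDivisibility.

Lemma expr_eq0_le (S : comPzRingType) (x : S) m n : (m <= n)%N -> x ^+ m = 0 -> x ^+ n = 0.
Proof. by move=> /subnKC <- xm0; rewrite exprD xm0 mul0r. Qed.

Lemma pdvd_rmorph (p : nat) (S T : comPzRingType) (f : {rmorphism S -> T}) k x :
  pdvd p k x -> pdvd p k (f x).
Proof. by case=> u ->; exists (f u); rewrite rmorphM rmorphXn rmorph_nat. Qed.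

Lemma Cp_rmorph (p : nat) (S T : comPzRingType) (f : {rmorphism S -> T}) x y :
  f (Cp p x y) = Cp p (f x) (f y).
Proof.
rewrite /Cp rmorphN rmorph_sum; congr (- _); apply: eq_bigr => i _.
by rewrite rmorphMn rmorphM !rmorphXn.
Qed.

(** Once p^k = 0, a Cauchy sequence is constant from index k on, so its k-th term is the limit. *)
Lemma padic_complete_nilpotent (p k : nat) (S : comPzRingType) :
  p%:R ^+ k = 0 :> S -> padic_complete p S.
Proof.
move=> pk0; have dvd0 (x : S) : pdvd p k x -> x = 0 by case=> y ->; rewrite pk0 mul0r.
split=> [x hx|u hu]; first exact: dvd0 (hx k).
exists (u k) => n; have [nk|kn] := leqP n k.
  by rewrite -(subnKC nk); apply: pdvd_cauchy.
have -> : u n = u k.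
  apply/eqP; rewrite -subr_eq0 -(subnKC (ltnW kn)); apply/eqP/dvd0.
  exact: pdvd_cauchy.
by rewrite subrr; apply: pdvd0.
Qed.

(** * Truncation of a prolongation sequence *)

Section PowerQuotient.
Variables (p : nat) (S : comPzRingType) (k : nat).
Implicit Types x y z : S.

Definition pquot_rel (x y : S) : bool := `[< pdvd p k (x - y) >].

Fact pquot_equiv : equiv_class_of pquot_rel.
Proof.
split=> [x|x y|y x z].
- by apply/asboolP; rewrite subrr; apply: pdvd0.
- by apply/asboolP/asboolP; apply: pdvd_subC.
- by move=> /asboolP xy /asboolP yz; apply/asboolP; apply: pdvd_subtrans xy yz.
Qed.

Canonical pquot_equiv_rel := EquivRelPack pquot_equiv.

Definition pquot := {eq_quot pquot_equiv_rel}%qT.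
HB.instance Definition _ := Choice.on pquot.

Definition pquot_pi x : pquot := \pi_pquot%qT x.
Definition pquot_repr (q : pquot) : S := repr q.

Lemma pquot_piP x y : pquot_pi x = pquot_pi y <-> pdvd p k (x - y).
Proof.
split=> [/(@eqmodP _ pquot_equiv_rel)/asboolP //|h].
by apply/(@eqmodP _ pquot_equiv_rel)/asboolP.
Qed.

Lemma pquot_reprK q : pquot_pi (pquot_repr q) = q. Proof. exact: reprK. Qed.

Lemma pquot_reprP x : pdvd p k (pquot_repr (pquot_pi x) - x).
Proof. by apply/pquot_piP; rewrite pquot_reprK. Qed.

Lemma pquot_ind (P : pquot -> Prop) : (forall x, P (pquot_pi x)) -> forall q, P q.
Proof. by move=> H q; rewrite -[q]pquot_reprK. Qed.

Let opp q := pquot_pi (- pquot_repr q).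
Let add q q' := pquot_pi (pquot_repr q + pquot_repr q').
Let mul q q' := pquot_pi (pquot_repr q * pquot_repr q').

Let oppE x : opp (pquot_pi x) = pquot_pi (- x).
Proof.
by apply/pquot_piP; rewrite opprK addrC; apply/pdvd_subC/pquot_reprP.
Qed.

Let addE x y : add (pquot_pi x) (pquot_pi y) = pquot_pi (x + y).
Proof.
by apply/pquot_piP; rewrite opprD addrACA; apply: pdvdD; apply: pquot_reprP.
Qed.

Let mulE x y : mul (pquot_pi x) (pquot_pi y) = pquot_pi (x * y).
Proof. by apply/pquot_piP/pdvd_subM; apply: pquot_reprP. Qed.

Fact pquot_addA : associative add.
Proof.
elim/pquot_ind=> x; elim/pquot_ind=> y; elim/pquot_ind=> z.
by rewrite !addE addrA.
Qed.
Fact pquot_addC : commutative add.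
Proof. by elim/pquot_ind=> x; elim/pquot_ind=> y; rewrite !addE addrC. Qed.
Fact pquot_add0 : left_id (pquot_pi 0) add.
Proof. by elim/pquot_ind=> x; rewrite addE add0r. Qed.
Fact pquot_addN : left_inverse (pquot_pi 0) opp add.
Proof. by elim/pquot_ind=> x; rewrite oppE addE addNr. Qed.
HB.instance Definition _ := GRing.isZmodule.Build pquot
  pquot_addA pquot_addC pquot_add0 pquot_addN.

Fact pquot_mulA : associative mul.
Proof.
elim/pquot_ind=> x; elim/pquot_ind=> y; elim/pquot_ind=> z.
by rewrite !mulE mulrA.
Qed.
Fact pquot_mulC : commutative mul.
Proof. by elim/pquot_ind=> x; elim/pquot_ind=> y; rewrite !mulE mulrC. Qed.
Fact pquot_mul1 : left_id (pquot_pi 1) mul.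
Proof. by elim/pquot_ind=> x; rewrite mulE mul1r. Qed.
Fact pquot_mulDl : left_distributive mul add.
Proof.
elim/pquot_ind=> x; elim/pquot_ind=> y; elim/pquot_ind=> z.
by rewrite !(mulE, addE) mulrDl.
Qed.
HB.instance Definition _ := GRing.Zmodule_isComPzRing.Build pquot
  pquot_mulA pquot_mulC pquot_mul1 pquot_mulDl.

Fact pquot_pi_zmod : zmod_morphism pquot_pi.
Proof.
move=> x y; transitivity (add (pquot_pi x) (opp (pquot_pi y))); last by [].
by rewrite oppE addE.
Qed.
Fact pquot_pi_monoid : monoid_morphism pquot_pi.
Proof. by split=> // x y; rewrite -[RHS]mulE. Qed.
HB.instance Definition _ := GRing.isZmodMorphism.Build S pquot pquot_pi pquot_pi_zmod.
HB.instance Definition _ := GRing.isMonoidMorphism.Build S pquot pquot_pi pquot_pi_monoid.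

Lemma pquot_nilpotent : p%:R ^+ k = 0 :> pquot.
Proof.
rewrite -(rmorph_nat pquot_pi) -rmorphXn -(rmorph0 pquot_pi).
by apply/pquot_piP; rewrite subr0 -[X in pdvd _ _ X]mulr1; apply: pdvdE.
Qed.

End PowerQuotient.
Arguments pquot_pi {p S} k x.

Definition pquot_lift (p : nat) (S : comPzRingType) (k : nat) (T : Type) (f : S -> T)
  (q : pquot p S k) : T := f (pquot_repr q).

Lemma pquot_liftE (p : nat) (S : comPzRingType) k (T : Type) (f : S -> T) :
    (forall x y, pdvd p k (x - y) -> f x = f y) ->
  forall x, pquot_lift f (pquot_pi k x : pquot p S k) = f x.
Proof. by move=> hf x; apply/hf/pquot_reprP. Qed.

(** * Congruences under p-derivations and derivations *)

Section PDerivationCongruence.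
Variables (p : nat) (p_pr : prime p) (S T : comPzRingType).
Variables (f : {rmorphism S -> T}) (dp : S -> T).
Hypothesis dpP : is_p_derivation p f dp.

(** Formally dp (p^k) = (p^k - p^(kp)) / p. Since T may have p-torsion, the bound is obtained from
    the product rule by induction. *)
Lemma p_derivation_expp k : pdvd p k.-1 (dp (p%:R ^+ k)).
Proof.
case: dpP => dp1 _ dpM; have p_gt0 := prime_gt0 p_pr.
elim: k => [|k IH]; first by rewrite expr0 dp1; apply: pdvd0.
rewrite exprSr dpM /= rmorphXn rmorph_nat -exprM.
apply: pdvdD; first apply: pdvdD.
- apply/pdvdMr/(@pdvd_le _ _ _ (k * p)); first by rewrite leq_pmulr.
  by rewrite -[_ ^+ _]mulr1; apply: pdvdE.
- case: k IH => [|k] IH; first exact: pdvd_zero.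
  rewrite /= in IH *; apply: (@pdvd_le _ _ _ (p + k)); first by rewrite -add1n leq_add2r.
  by apply: pdvdM => //; rewrite -[_ ^+ _]mulr1; apply: pdvdE.
- case: k IH => [|k] IH; first exact: pdvd_zero.
  rewrite -addn1 addnC; apply: pdvdM; last exact: pdvdMr.
  by rewrite -[_%:R]mulr1; apply: pdvdE.
Qed.

(** With x = y + p^k z, the difference is dp (p^k z) plus a value of [Cp], each term of which
    contains a positive power of f (p^k z). The power of p lost here dictates the moduli in
    [trunc_ring]. *)
Lemma p_derivation_congr k x y : pdvd p k (x - y) -> pdvd p k.-1 (dp x - dp y).
Proof.
case: dpP => dp1 dpD dpM [z /eqP]; rewrite subr_eq addrC => /eqP ->.
have hC : pdvd p k (Cp p (f y) (f (p%:R ^+ k * z))).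
  rewrite /Cp; apply/pdvdN; rewrite big_nat_cond; apply: pdvd_sum => i; rewrite andbT.
  case/andP=> i_gt0 _; apply/pdvdMn/pdvdMl/pdvdX => //.
  by apply: pdvd_rmorph; apply: pdvdE.
rewrite dpD addrAC [dp y + _]addrC addrK.
apply: pdvdD; last exact: pdvd_le (leq_pred k) hC.
rewrite dpM rmorphXn rmorph_nat; apply: pdvdD; first apply: pdvdD.
- apply/pdvdMr/pdvdX; first exact: prime_gt0.
  by rewrite -[_ ^+ _]mulr1; apply: pdvd_le (leq_pred k) _; apply: pdvdE.
- exact/pdvdMl/p_derivation_expp.
- exact/pdvdMl/pdvdMr/p_derivation_expp.
Qed.

End PDerivationCongruence.

Lemma derivation_congr (p : nat) (S T : comPzRingType) (f dq : S -> T) k x y :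
  is_derivation f dq -> pdvd p k (x - y) -> pdvd p k (dq x - dq y).
Proof.
move=> dqP [z /eqP]; rewrite subr_eq addrC => /eqP ->; case: (dqP) => dqD _.
rewrite dqD addrAC subrr add0r -natrX (derivation_natl _ _ dqP) natrX.
exact: pdvdE.
Qed.
Section Truncation.
Variables (p : nat) (p_pr : prime p) (S : prolseq p) (N : nat).

(** The modulus p^(N - n) drops by one per level because [ps_dp] loses one power of p. From level N
    on the ring is zero. *)
Definition trunc_ring (n : nat) : comPzRingType := pquot p (S n) (N - n).

Definition trunc_pi (n : nat) : {rmorphism S n -> trunc_ring n} := pquot_pi (N - n).

Lemma trunc_piP n (x y : S n) : trunc_pi n x = trunc_pi n y <-> pdvd p (N - n) (x - y).
Proof. exact: pquot_piP. Qed.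

Lemma trunc_ind n (P : trunc_ring n -> Prop) :
  (forall x, P (trunc_pi n x)) -> forall q, P q.
Proof. exact: pquot_ind. Qed.

Definition trunc_phi n : trunc_ring n -> trunc_ring n.+1 :=
  pquot_lift (fun x => trunc_pi n.+1 (ps_phi x)).
Definition trunc_dp n : trunc_ring n -> trunc_ring n.+1 :=
  pquot_lift (fun x => trunc_pi n.+1 (ps_dp x)).
Definition trunc_dq n : trunc_ring n -> trunc_ring n.+1 :=
  pquot_lift (fun x => trunc_pi n.+1 (ps_dq x)).

Lemma trunc_phiE n (x : S n) : trunc_phi (trunc_pi n x) = trunc_pi n.+1 (ps_phi x).
Proof.
apply: pquot_liftE => y z h; apply/trunc_piP; rewrite -rmorphB.
by apply: pdvd_rmorph; apply: pdvd_le h; rewrite subnS leq_pred.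
Qed.

Lemma trunc_dpE n (x : S n) : trunc_dp (trunc_pi n x) = trunc_pi n.+1 (ps_dp x).
Proof.
apply: pquot_liftE => y z h; apply/trunc_piP; rewrite subnS.
exact: (p_derivation_congr p_pr (ps_dpP S n)).
Qed.

Lemma trunc_dqE n (x : S n) : trunc_dq (trunc_pi n x) = trunc_pi n.+1 (ps_dq x).
Proof.
apply: pquot_liftE => y z h; apply/trunc_piP; case: (ps_dqP S n) => dqP _.
apply: (derivation_congr dqP); apply: pdvd_le h; by rewrite subnS leq_pred.
Qed.

Fact trunc_phi_zmod n : zmod_morphism (@trunc_phi n).
Proof.
elim/trunc_ind=> x; elim/trunc_ind=> y.
by rewrite -rmorphB !trunc_phiE !rmorphB.
Qed.
Fact trunc_phi_monoid n : monoid_morphism (@trunc_phi n).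
Proof.
split; first by rewrite -(rmorph1 (trunc_pi n)) trunc_phiE !rmorph1.
elim/trunc_ind=> x; elim/trunc_ind=> y.
by rewrite -rmorphM !trunc_phiE !rmorphM.
Qed.
HB.instance Definition _ n :=
  GRing.isZmodMorphism.Build (trunc_ring n) (trunc_ring n.+1) (@trunc_phi n) (@trunc_phi_zmod n).
HB.instance Definition _ n :=
  GRing.isMonoidMorphism.Build (trunc_ring n) (trunc_ring n.+1) (@trunc_phi n) (@trunc_phi_monoid n).

Let truncE := (trunc_phiE, trunc_dpE, trunc_dqE).

Fact trunc_dpP n : is_p_derivation p (@trunc_phi n) (@trunc_dp n).
Proof.
have [dp1 dpD dpM] := ps_dpP S n; split.
- by rewrite -(rmorph1 (trunc_pi n)) trunc_dpE dp1 rmorph0.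
- elim/trunc_ind=> x; elim/trunc_ind=> y.
  by rewrite -rmorphD !truncE dpD !rmorphD Cp_rmorph.
- elim/trunc_ind=> x; elim/trunc_ind=> y.
  by rewrite -rmorphM !truncE dpM !rmorphD !rmorphM /= !rmorphXn rmorph_nat.
Qed.

Fact trunc_dqP n :
  is_dp_derivation p (@trunc_phi n) (@trunc_dp n) (@trunc_dq n)
    (@trunc_phi n.+1) (@trunc_dp n.+1) (@trunc_dq n.+1).
Proof.
have [[dqD dqM] dqdp] := ps_dqP S n; split; first split.
- elim/trunc_ind=> x; elim/trunc_ind=> y.
  by rewrite -rmorphD !truncE dqD !rmorphD.
- elim/trunc_ind=> x; elim/trunc_ind=> y.
  by rewrite -rmorphM !truncE dqM !rmorphD !rmorphM.
elim/trunc_ind=> x.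
by rewrite !truncE dqdp !(rmorphB, rmorphD, rmorphM) !rmorphXn rmorph_nat.
Qed.

Fact trunc_dp_phi n x : trunc_dp (@trunc_phi n x) = trunc_phi (trunc_dp x).
Proof. by elim/trunc_ind: x => x; rewrite !truncE ps_dp_phi. Qed.

Fact trunc_dq_phi n x : trunc_dq (@trunc_phi n x) = trunc_phi (trunc_dq x).
Proof. by elim/trunc_ind: x => x; rewrite !truncE ps_dq_phi. Qed.

Definition trunc : prolseq p :=
  @ProlSeq p trunc_ring (fun n => @trunc_phi n) trunc_dp trunc_dq
    trunc_dpP trunc_dqP trunc_dp_phi trunc_dq_phi.

Definition trunc_mor : ps_mor S trunc :=
  @PSMor p S trunc trunc_pi (fun n x => esym (trunc_phiE x))
    (fun n x => esym (trunc_dpE x)) (fun n x => esym (trunc_dqE x)).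

Lemma trunc_nilpotent n : p%:R ^+ (N - n) = 0 :> trunc n.
Proof. exact: pquot_nilpotent. Qed.

Lemma trunc_complete : ps_complete trunc.
Proof. by move=> n; apply: (padic_complete_nilpotent (trunc_nilpotent n)). Qed.

Section Lift.
Variables (T : prolseq p) (g : ps_mor S T).
Hypothesis T_nilpotent : forall n, p%:R ^+ (N - n) = 0 :> T n.

Definition lift_fun n : trunc n -> T n := pquot_lift (g n).

Lemma lift_funE n (x : S n) : lift_fun (trunc_pi n x) = g n x.
Proof.
apply: pquot_liftE => y z /(pdvd_rmorph (g n)) [w].
by rewrite T_nilpotent mul0r rmorphB => /eqP; rewrite subr_eq0 => /eqP.
Qed.

Fact lift_fun_zmod n : zmod_morphism (@lift_fun n).
Proof.
elim/trunc_ind=> x; elim/trunc_ind=> y.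
by rewrite -[_ - _](rmorphB (trunc_pi n)) !lift_funE !rmorphB.
Qed.
Fact lift_fun_monoid n : monoid_morphism (@lift_fun n).
Proof.
split; first by rewrite -[1](rmorph1 (trunc_pi n)) lift_funE !rmorph1.
elim/trunc_ind=> x; elim/trunc_ind=> y.
by rewrite -[_ * _](rmorphM (trunc_pi n)) !lift_funE !rmorphM.
Qed.
HB.instance Definition _ n :=
  GRing.isZmodMorphism.Build (trunc n) (T n) (@lift_fun n) (@lift_fun_zmod n).
HB.instance Definition _ n :=
  GRing.isMonoidMorphism.Build (trunc n) (T n) (@lift_fun n) (@lift_fun_monoid n).

Fact lift_phi n x : lift_fun (ps_phi x : trunc n.+1) = ps_phi (lift_fun x).
Proof. by elim/trunc_ind: x => x; rewrite /= trunc_phiE !lift_funE psm_phi. Qed.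
Fact lift_dp n x : lift_fun (ps_dp x : trunc n.+1) = ps_dp (lift_fun x).
Proof. by elim/trunc_ind: x => x; rewrite /= trunc_dpE !lift_funE psm_dp. Qed.
Fact lift_dq n x : lift_fun (ps_dq x : trunc n.+1) = ps_dq (lift_fun x).
Proof. by elim/trunc_ind: x => x; rewrite /= trunc_dqE !lift_funE psm_dq. Qed.

(** Truncation at N is universal among morphisms from S to sequences whose n-th level is killed by
    p^(N - n). *)
Definition trunc_lift : ps_mor trunc T :=
  @PSMor p trunc T (fun n => @lift_fun n) lift_phi lift_dp lift_dq.

Lemma trunc_liftE n (x : S n) : trunc_lift n (trunc_pi n x) = g n x.
Proof. exact: lift_funE. Qed.

End Lift.
End Truncation.

Section TruncationOver.
Variables (p : nat) (p_pr : prime p) (A : comPzRingType) (D : pq_structure p A).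
Implicit Types S T U : prolseq_over D.

Fact comp_phi (S T U : prolseq p) (h : ps_mor T U) (g : ps_mor S T) n x :
  (h n.+1 \o g n.+1) (ps_phi x) = ps_phi ((h n \o g n) x).
Proof. by rewrite /= !psm_phi. Qed.
Fact comp_dp (S T U : prolseq p) (h : ps_mor T U) (g : ps_mor S T) n x :
  (h n.+1 \o g n.+1) (ps_dp x) = ps_dp ((h n \o g n) x).
Proof. by rewrite /= !psm_dp. Qed.
Fact comp_dq (S T U : prolseq p) (h : ps_mor T U) (g : ps_mor S T) n x :
  (h n.+1 \o g n.+1) (ps_dq x) = ps_dq ((h n \o g n) x).
Proof. by rewrite /= !psm_dq. Qed.

Definition ps_comp (S T U : prolseq p) (h : ps_mor T U) (g : ps_mor S T) : ps_mor S U :=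
  @PSMor p S U (fun n => h n \o g n) (comp_phi h g) (comp_dp h g) (comp_dq h g).

Fact comp_str S T U (h : ps_mor_over T U) (g : ps_mor_over S T) n a :
  ps_comp h g n (po_str S n a) = po_str U n a.
Proof. by rewrite /= !pmo_str. Qed.

Definition ps_comp_over S T U (h : ps_mor_over T U) (g : ps_mor_over S T) :
  ps_mor_over S U := @PSMorOver p A D S U (ps_comp h g) (comp_str h g).

Definition trunc_over S N : prolseq_over D :=
  @ProlSeqOver p A D (trunc p_pr S N) (ps_comp (trunc_mor p_pr S N) (po_str S)).

Lemma trunc_over_complete S N : ps_complete (trunc_over S N).
Proof. exact: trunc_complete. Qed.

Lemma trunc_over_nilpotent S N n : p%:R ^+ (N - n) = 0 :> trunc_over S N n.
Proof. exact: trunc_nilpotent. Qed.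

Definition trunc_mor_over S N : ps_mor_over S (trunc_over S N) :=
  @PSMorOver p A D S (trunc_over S N) (trunc_mor p_pr S N) (fun n a => erefl).

Fact trunc_lift_str S T N (g : ps_mor_over S T)
    (hT : forall n, p%:R ^+ (N - n) = 0 :> T n) n a :
  trunc_lift p_pr g hT n (po_str (trunc_over S N) n a) = po_str T n a.
Proof. by rewrite -(pmo_str g); exact: trunc_liftE. Qed.

Definition trunc_lift_over S T N (g : ps_mor_over S T)
    (hT : forall n, p%:R ^+ (N - n) = 0 :> T n) : ps_mor_over (trunc_over S N) T :=
  @PSMorOver p A D (trunc_over S N) T (trunc_lift p_pr g hT) (trunc_lift_str g hT).

End TruncationOver.

(** * Polynomials in an arbitrary set of variables *)

Local Notation "1" := (@mone _) : monom_scope.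
Local Notation "x * y" := (@mmul _ x y) : monom_scope.

Section MonomialInduction.
Variable I : choiceType.
Implicit Types k : {cmonom I}.

Lemma cmonom_factor k : k != 1%M -> exists i k', k = (ucm i * k')%M.
Proof.
move=> k1; have [i ik] : exists i, i \in finsupp k.
  apply/fset0Pn; apply: contraNneq k1 => k0; apply/cmP => i.
  by rewrite cm1; apply/eqP; rewrite cmE_eq0 k0.
exists i, (divcm k (ucm i)); apply/eqP/cmP => j; rewrite cmM cmU divcmE cmU.
by case: eqP => [<-|_]; rewrite ?subn0 ?subnKC // lt0n cmE_neq0.
Qed.

Lemma cmonom_ind (K : {cmonom I} -> Prop) :
  K 1%M -> (forall i k, K k -> K (ucm i * k)%M) -> forall k, K k.
Proof.
move=> K1 KM k; have [n] := ubnP (mdeg k); elim: n k => // n IH k.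
have [->//|/cmonom_factor[i [k' ->]]] := eqVneq k 1%M.
by rewrite mdegM mdegU add1n ltnS => /IH/KM; apply.
Qed.

End MonomialInduction.

(* [mmap] of [monalg] requires a nontrivial target ring, whereas the levels of  *)
(* a prolongation sequence may be zero.                                         *)
Section Evaluation.
Variables (R : comNzRingType) (I : choiceType) (S : comPzRingType).
Variables (f : {rmorphism R -> S}) (h : I -> S).
Local Notation P := {malg R[{cmonom I}]}.
Implicit Types (k : {cmonom I}) (x y : P).

Definition monom_eval k : S := \prod_(i <- finsupp k) h i ^+ k i.

Lemma monom_evalEw (d : {fset I}) k : (finsupp k `<=` d)%fset ->
  monom_eval k = \prod_(i <- d) h i ^+ k i.
Proof.
move=> kd; rewrite /monom_eval (big_fset_incl _ kd) // => i _.
by rewrite -cmE_eq0 => /eqP ->; rewrite expr0.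
Qed.

Lemma monom_eval1 : monom_eval 1%M = 1.
Proof. by rewrite /monom_eval mdom1 big_seq_fset0. Qed.

Lemma monom_evalM k k' : monom_eval (k * k')%M = monom_eval k * monom_eval k'.
Proof.
rewrite (monom_evalEw (fsubsetUl (finsupp k) (finsupp k'))).
rewrite (monom_evalEw (fsubsetUr (finsupp k) (finsupp k'))).
rewrite /monom_eval mdomD -big_split; apply: eq_bigr => i _.
by rewrite cmM exprD.
Qed.

Definition mpeval x : S := \sum_(k <- msupp x) f x@_k * monom_eval k.

Lemma mpevalEw (d : {fset {cmonom I}}) x : (msupp x `<=` d)%fset ->
  mpeval x = \sum_(k <- d) f x@_k * monom_eval k.
Proof.
move=> xd; rewrite /mpeval (big_fset_incl _ xd) // => k _ kx.
by rewrite mcoeff_outdom // rmorph0 mul0r.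
Qed.

Lemma mpevalD x y : mpeval (x + y) = mpeval x + mpeval y.
Proof.
rewrite (mpevalEw (fsubsetUl (msupp x) (msupp y))).
rewrite (mpevalEw (fsubsetUr (msupp x) (msupp y))).
rewrite (mpevalEw (msuppD_le x y)) -big_split; apply: eq_bigr => k _.
by rewrite mcoeffD rmorphD mulrDl.
Qed.

Lemma mpevalU c k : mpeval << c *g k >> = f c * monom_eval k.
Proof. by rewrite (mpevalEw msuppU_le) big_seq_fset1 mcoeffUU. Qed.

Lemma mpevalC c : mpeval c%:MP = f c.
Proof. by rewrite mpevalU monom_eval1 mulr1. Qed.

Lemma mpevalX i : mpeval << ucm i >> = h i.
Proof.
by rewrite mpevalU rmorph1 mul1r /monom_eval mdomU big_seq_fset1 cmUU expr1.
Qed.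

Fact mpeval_zmod : zmod_morphism mpeval.
Proof. by move=> x y; apply/eqP; rewrite eq_sym subr_eq -mpevalD subrK. Qed.

HB.instance Definition _ := GRing.isZmodMorphism.Build P S mpeval mpeval_zmod.

Fact mpeval_monoid : monoid_morphism mpeval.
Proof.
split=> [|x y]; first by rewrite mpevalC rmorph1.
rewrite malgME raddf_sum mulr_suml; apply: eq_bigr => k _.
rewrite raddf_sum mulr_sumr; apply: eq_bigr => k' _.
by rewrite [LHS]mpevalU rmorphM monom_evalM mulrACA.
Qed.

HB.instance Definition _ := GRing.isMonoidMorphism.Build P S mpeval mpeval_monoid.

End Evaluation.

Record polyring (R : comNzRingType) (I : choiceType) := PolyRing {
  pr_car :> comNzRingType;
  pr_const : {rmorphism R -> pr_car};
  pr_mon : {cmonom I} -> pr_car;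
  pr_coef : {cmonom I} -> {additive pr_car -> R};
  pr_mon1 : pr_mon 1%M = 1;
  pr_monM : forall k k', pr_mon (k * k')%M = pr_mon k * pr_mon k';
  pr_coef_mon : forall k k', pr_coef k (pr_mon k') = (k == k')%:R;
  pr_coefCM : forall c x k, pr_coef k (pr_const c * x) = c * pr_coef k x;
  pr_sum : forall x, exists s : seq {cmonom I}, x = \sum_(k <- s) pr_const (pr_coef k x) * pr_mon k;
  pr_eval : forall (S : comPzRingType) (f : {rmorphism R -> S}) (h : I -> S),
    {g : {rmorphism pr_car -> S} |
      (forall c, g (pr_const c) = f c) /\ (forall i, g (pr_mon (ucm i)) = h i)} }.

(* Proved with [Qed] on purpose: polynomials are used through the interface     *)
(* [polyring] only, lest unification unfold the operations of [malg].           *)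
Definition free_polyring (R : comNzRingType) (I : choiceType) : polyring R I.
Proof.
pose P : comNzRingType := {malg R[{cmonom I}]}.
apply: (@PolyRing R I P malgC (fun k => << k >>) (fun k => mcoeff k)) => //.
- by move=> k k'; rewrite malgM_def fgmulUU mulr1.
- by move=> k k'; rewrite eq_sym; apply: mcoeffU1.
- by move=> c x k; apply: mcoeffCM.
- move=> x; exists (msupp x); rewrite [LHS]monalgE; apply: eq_bigr => k _.
  by rewrite malgM_def fgmulUU mulr1 mul1m.
- move=> S f h; exists (mpeval f h); split=> [c|i]; first exact: mpevalC.
  exact: mpevalX.
Qed.

Section PolyringTheory.
Variables (R : comNzRingType) (I : choiceType) (P : polyring R I).
Implicit Types (k : {cmonom I}) (x y : P).

Definition pr_var (i : I) : P := pr_mon P (ucm i).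

Lemma pr_ext x y : (forall k, pr_coef P k x = pr_coef P k y) -> x = y.
Proof.
move=> xy; apply/eqP; rewrite -subr_eq0; have [s ->] := pr_sum (x - y).
rewrite big1 // => k _; by rewrite raddfB xy subrr rmorph0 mul0r.
Qed.

Lemma pr_sum_ind (K : P -> Prop) :
    (forall x y, K x -> K y -> K (x + y)) -> K 0 ->
  forall x, (forall k, K (pr_const P (pr_coef P k x) * pr_mon P k)) -> K x.
Proof.
move=> KD K0 x Kx; have [s ->] := pr_sum x.
by elim/big_rec: _ => // k y _ Ky; apply: KD.
Qed.

Lemma pr_ind (K : P -> Prop) :
    (forall c, K (pr_const P c)) -> (forall i, K (pr_var i)) ->
    (forall x y, K x -> K y -> K (x + y)) ->
    (forall x y, K x -> K y -> K (x * y)) ->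
  forall x, K x.
Proof.
move=> KC KX KD KM x; apply: pr_sum_ind => // [|k].
  by rewrite -(rmorph0 (pr_const P)); apply: KC.
apply: (KM) => //; elim/cmonom_ind: k => [|i k Kk].
  by rewrite pr_mon1 -(rmorph1 (pr_const P)); apply: KC.
by rewrite pr_monM; apply: KM => //; apply: KX.
Qed.

Lemma pr_rmorph_ext (S : comPzRingType) (f g : {rmorphism P -> S}) :
    (forall c, f (pr_const P c) = g (pr_const P c)) ->
    (forall i, f (pr_var i) = g (pr_var i)) ->
  f =1 g.
Proof.
move=> fgC fgX; elim/pr_ind => // x y; first by rewrite !rmorphD => -> ->.
by rewrite !rmorphM => -> ->.
Qed.

(** * The filtration by powers of the ideal of the variables *)

Definition fil (d : nat) x : Prop := forall k, (mdeg k < d)%N -> pr_coef P k x = 0.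

Lemma fil0 d : fil d 0. Proof. by move=> k _; rewrite raddf0. Qed.

Lemma filD d x y : fil d x -> fil d y -> fil d (x + y).
Proof. by move=> hx hy k kd; rewrite raddfD hx // hy // addr0. Qed.

Lemma filB d x y : fil d x -> fil d y -> fil d (x - y).
Proof. by move=> hx hy k kd; rewrite raddfB hx // hy // subr0. Qed.

Lemma fil_le d e x : fil e x -> (d <= e)%N -> fil d x.
Proof. by move=> hx de k kd; apply: hx; apply: leq_trans de. Qed.

Lemma filCM d c x : fil d x -> fil d (pr_const P c * x).
Proof. by move=> hx k kd; rewrite pr_coefCM hx // mulr0. Qed.

Lemma fil_mon k : fil (mdeg k) (pr_mon P k).
Proof.
by move=> k' k'k; rewrite pr_coef_mon; case: eqP k'k => // ->; rewrite ltnn.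
Qed.

Lemma fil_ind d (K : P -> Prop) :
    (forall x y, K x -> K y -> K (x + y)) -> K 0 ->
    (forall c k, (d <= mdeg k)%N -> K (pr_const P c * pr_mon P k)) ->
  forall x, fil d x -> K x.
Proof.
move=> KD K0 KM x hx; apply: pr_sum_ind => // k; have [kd|] := ltnP (mdeg k) d.
  by rewrite hx // rmorph0 mul0r.
exact: KM.
Qed.

Lemma fil_zero x : fil 0 x. Proof. by []. Qed.

Lemma filM d e x y : fil d x -> fil e y -> fil (d + e) (x * y).
Proof.
move=> hx hy; move: x hx; apply: fil_ind => [x x' hx hx'||c k dk].
- by rewrite mulrDl; apply: filD.
- by rewrite mul0r; apply: fil0.
rewrite -mulrA; apply: filCM; move: y hy; apply: fil_ind => [y y' hy hy'||c' k' ek'].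
- by rewrite mulrDr; apply: filD.
- by rewrite mulr0; apply: fil0.
rewrite mulrCA; apply: filCM; rewrite -pr_monM; apply: (fil_le (@fil_mon _)).
by rewrite mdegM leq_add.
Qed.

Lemma filX n x : fil 1 x -> fil n (x ^+ n).
Proof.
move=> hx; elim: n => [|n IH]; first exact: fil_zero.
by rewrite exprS -add1n; apply: filM.
Qed.

Lemma pr_natE n : n%:R = pr_const P n%:R. Proof. by rewrite rmorph_nat. Qed.

Lemma filMnat d n x : fil d x -> fil d (n%:R * x).
Proof. by rewrite pr_natE; apply: filCM. Qed.

(** The map s allows for [jphi], which acts on the coefficients through phi_p. *)
Lemma fil_rmorph (g : {rmorphism P -> P}) (s : R -> R) d x :
    (forall c, g (pr_const P c) = pr_const P (s c)) -> (forall i, fil 1 (g (pr_var i))) ->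
  fil d x -> fil d (g x).
Proof.
move=> gC gX; move: x; apply: fil_ind => [x y hx hy||c k dk].
- by rewrite rmorphD; apply: filD.
- by rewrite rmorph0; apply: fil0.
rewrite rmorphM gC; apply: filCM; apply: (fil_le _ dk).
elim/cmonom_ind: {dk} k => [|i k IH]; first by rewrite mdeg1; apply: fil_zero.
by rewrite pr_monM rmorphM mdegM mdegU; apply: filM => //; apply: gX.
Qed.

Lemma pr_coefCE c k : pr_coef P k (pr_const P c) = c * (k == 1%M)%:R.
Proof. by rewrite -[pr_const P c]mulr1 pr_coefCM -pr_mon1 pr_coef_mon. Qed.

Lemma fil1_var i : fil 1 (pr_var i).
Proof. by rewrite -(mdegU i); apply: fil_mon. Qed.

(** Once constant terms are split off, the product of the two remainders has degree at least 2 and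
    contributes nothing linear. *)
Lemma pr_coef_linM i x y : pr_coef P (ucm i) (x * y) =
  pr_coef P 1%M x * pr_coef P (ucm i) y + pr_coef P 1%M y * pr_coef P (ucm i) x.
Proof.
have split0 z : exists2 z', fil 1 z' & z = pr_const P (pr_coef P 1%M z) + z'.
  exists (z - pr_const P (pr_coef P 1%M z)); last by rewrite addrC subrK.
  move=> k; rewrite ltnS leqn0 mdeg_eq0 => /eqP ->.
  by rewrite raddfB pr_coefCE eqxx mulr1 subrr.
have constU (c : R) : pr_coef P (ucm i) (pr_const P c) = 0.
  by rewrite pr_coefCE cm1_eq1 mulr0.
have [x' hx ex] := split0 x; have [y' hy ey] := split0 y.
have cx : pr_coef P (ucm i) x = pr_coef P (ucm i) x' by rewrite ex raddfD constU /= add0r.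
have cy : pr_coef P (ucm i) y = pr_coef P (ucm i) y' by rewrite ey raddfD constU /= add0r.
rewrite cx cy; move: ex ey; set c := pr_coef _ _ x; set d := pr_coef _ _ y => -> ->.
rewrite mulrDl 2!mulrDr [x' * pr_const _ _]mulrC -rmorphM !raddfD /= !pr_coefCM.
by rewrite !constU !add0r (filM hx hy) ?mdegU // addr0.
Qed.

(** * p-adic estimates on coefficients and rigidity under doubling *)

Section PadicCoefficients.
Variable p : nat.

Lemma pr_coef_pexp n k x : pr_coef P k (p%:R ^+ n * x) = p%:R ^+ n * pr_coef P k x.
Proof. by rewrite -natrX pr_natE pr_coefCM natrX. Qed.

Lemma pdvd_coefP n x : pdvd p n x <-> forall k, pdvd p n (pr_coef P k x).
Proof.
split=> [[y ->] k|h]; first by rewrite pr_coef_pexp; apply: pdvdE.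
apply: pr_sum_ind => [y z||k]; first exact: pdvdD.
  exact: pdvd0.
by apply/pdvdMr/pdvd_rmorph.
Qed.

Definition pfil (n d : nat) x : Prop :=
  forall k, (mdeg k < d)%N -> pdvd p n (pr_coef P k x).

Lemma pfilD n d x y : pfil n d x -> pfil n d y -> pfil n d (x + y).
Proof. by move=> hx hy k kd; rewrite raddfD; apply: pdvdD; [apply: hx | apply: hy]. Qed.

Lemma fil_pfil n d x : fil d x -> pfil n d x.
Proof. by move=> hx k kd; rewrite hx //; apply: pdvd0. Qed.

Lemma pdvd_pfil n d x : pdvd p n x -> pfil n d x.
Proof. by move=> /pdvd_coefP hx k _; apply: hx. Qed.

Hypothesis p_pr : prime p.
Hypothesis pI : forall a b : R, p%:R * a = p%:R * b -> a = b.

(** Write q = p^e m with m prime to p; by Bezout m is invertible modulo every p^n. The loss e must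
    not depend on n for [dbl_rigid]. *)
Lemma pdvd_natM q : (0 < q)%N -> exists e, forall n (a : R),
  pdvd p (n + e) (q%:R * a) -> pdvd p n a.
Proof.
move=> q_gt0; have [m pm ->] := pfactor_coprime p_pr q_gt0; set e := logn p q.
exists e => n a; rewrite natrM natrX -mulrA mulrCA addnC => /(pdvd_cancel pI) h.
have m_gt0 : (0 < m)%N.
  rewrite lt0n; apply: contraTneq pm => ->.
  by rewrite /coprime gcdn0; case: p p_pr => [|[]].
have /(coprimeP _ m_gt0)[[u v] /= e1] : coprime m (p ^ n).
  by rewrite coprime_sym coprimeXl.
have {}e1 : (u * m = 1 + v * p ^ n)%N.
  by rewrite -e1 subnK // ltnW // -subn_gt0 e1.
have -> : a = u%:R * (m%:R * a) - v%:R * (p%:R ^+ n * a).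
  by rewrite !mulrA -natrM e1 natrD natrM natrX mulrDl mul1r addrK.
by apply: pdvdB; apply: pdvdMl => //; apply: pdvdE.
Qed.

Variable dbl : {rmorphism P -> P}.
Hypothesis dblC : forall c, dbl (pr_const P c) = pr_const P c.
Hypothesis dblX : forall i, fil 2 (dbl (pr_var i) - 2%:R * pr_var i).

Lemma dbl_mon k : fil (mdeg k).+1 (dbl (pr_mon P k) - 2%:R ^+ mdeg k * pr_mon P k).
Proof.
elim/cmonom_ind: k => [|i k IH].
  by rewrite pr_mon1 rmorph1 mdeg1 mulr1 expr0 subrr; apply: fil0.
have e1 : fil 1 (dbl (pr_var i)).
  rewrite -[dbl _](subrK (2%:R * pr_var i)); apply: filD; first exact: (fil_le (dblX i)).
  exact/filMnat/fil1_var.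
rewrite pr_monM rmorphM mdegM mdegU exprD expr1 mulrACA.
rewrite -(subrKA (dbl (pr_var i) * (2%:R ^+ mdeg k * pr_mon P k))) -mulrBr -mulrBl add1n.
apply: filD; first by rewrite -add1n; apply: filM.
rewrite -[(mdeg k).+2]add2n; apply: filM; first exact: dblX.
by rewrite -natrX; apply/filMnat/fil_mon.
Qed.

(** Monomials of degree below d have coefficients divisible by p^n, those of degree d are multiplied
    by 2^d up to higher degree, and those above d do not count. *)
Lemma dbl_lead n d x : pfil n d x -> pfil n d.+1 (dbl x - 2%:R ^+ d * x).
Proof.
move=> hx; have [s ->] := pr_sum x.
elim/big_rec: _ => [|k y _ hy].
  by rewrite rmorph0 mulr0 subrr; apply/fil_pfil/fil0.
rewrite rmorphD mulrDr opprD addrACA; apply: pfilD hy.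
rewrite rmorphM dblC mulrCA -mulrBr; have [kd|dk|kd] := ltngtP (mdeg k) d.
- by apply/pdvd_pfil/pdvdMr/pdvd_rmorph; apply: hx.
- apply/fil_pfil/filCM/filB; last first.
    by rewrite -natrX; apply/filMnat/(fil_le (@fil_mon _)).
  rewrite -[dbl _](subrK (2%:R ^+ mdeg k * pr_mon P k)); apply: filD.
    by apply: (fil_le (@dbl_mon k)); apply: ltnW.
  by rewrite -natrX; apply/filMnat/(fil_le (@fil_mon _)).
- by rewrite -kd; apply/fil_pfil/filCM/dbl_mon.
Qed.

(* A homogeneous form of degree d satisfying [dbl x = 2 x] is killed by         *)
(* [2 ^ d - 2], whose p-adic valuation is independent of the precision n.       *)
Lemma dbl_rigid (g : nat -> P) :
    (forall n, pdvd p n (g n.+1 - g n)) ->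
    (forall n, pdvd p n (dbl (g n) - 2%:R * g n)) ->
    (forall n i, pdvd p n (pr_coef P (ucm i) (g n))) ->
  forall n, pdvd p n (g n).
Proof.
(* Induction on the degree, for all precisions at once: the step for n uses the lower degrees at
   precision n + e. *)
move=> g_cauchy g_dbl g_lin n; suff h d : forall n, pfil n d (g n).
  by apply/pdvd_coefP => k; apply: (h (mdeg k).+1).
elim: d => [|d IH] {}n; first by move=> k.
move=> k; rewrite ltnS leq_eqVlt => /predU1P[kd|]; last exact: IH.
have [d1|d1] := eqVneq d 1%N.
  have [i ->] : exists i, k = ucm i.
    have [k1|/cmonom_factor[i [k' kE]]] := eqVneq k 1%M.
      by move: kd; rewrite k1 mdeg1 d1.
    exists i; rewrite kE; move: kd; rewrite kE mdegM mdegU d1 add1n => -[/eqP].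
    by rewrite mdeg_eq0 => /eqP ->; rewrite mulm1.
  exact: g_lin.
have coef_dbl m : pdvd p m ((2 ^ d)%:R * pr_coef P k (g m) - 2%:R * pr_coef P k (g m)).
  have h1 : pdvd p m (pr_coef P k (dbl (g m) - 2%:R ^+ d * g m)).
    by apply: (dbl_lead (IH m)); rewrite ltnS kd.
  have /pdvd_coefP/(_ k) h2 := g_dbl m.
  have := pdvdB h2 h1; rewrite -raddfB.
  have -> : dbl (g m) - 2%:R * g m - (dbl (g m) - 2%:R ^+ d * g m)
      = (2 ^ d)%:R * g m - 2%:R * g m by rewrite natrX; ring.
  by rewrite raddfB !pr_natE !pr_coefCM.
(* q is the absolute value of 2^d - 2: it is 1 for d = 0 and positive for d at least 2; d = 1 was
   settled by [g_lin]. *)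
have [q q_gt0 hq] : exists2 q, (0 < q)%N &
    forall m, pdvd p m (q%:R * pr_coef P k (g m)).
  case: d d1 {IH kd} coef_dbl => [|[|d]] // _ coef_dbl.
    exists 1%N => // m; have := pdvdN (coef_dbl m).
    by rewrite opprB -mulrBl -natrB.
  exists (2 ^ d.+2 - 2)%N; last first.
    by move=> m; rewrite natrB ?mulrBl; [apply: coef_dbl | rewrite -{1}(expn1 2) leq_exp2l].
  by rewrite subn_gt0 -{1}(expn1 2) ltn_exp2l.
have [e he] := pdvd_natM q_gt0.
(* The estimate holds for g (n + e) and is carried back to g n by the Cauchy condition. *)
have hk : pdvd p n (pr_coef P k (g (n + e)%N)) by apply: he.
have /pdvd_coefP/(_ k) := @pdvd_cauchy p P g e n g_cauchy.
by rewrite raddfB => /pdvd_subC /pdvdD/(_ hk); rewrite subrK.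
Qed.

End PadicCoefficients.

End PolyringTheory.

(** * Frobenius lifts and p-derivations *)

Section PhipMorphism.
Variables (p : nat) (p_pr : prime p) (S T : comPzRingType).
Variables (f : {rmorphism S -> T}) (dp : S -> T).
Hypothesis dpP : is_p_derivation p f dp.

Fact phip_zmod : zmod_morphism (phip p f dp).
Proof.
by move=> x y; apply/eqP; rewrite eq_sym subr_eq -(phipD p_pr dpP) subrK.
Qed.

Fact phip_monoid : monoid_morphism (phip p f dp).
Proof.
split; last exact: phipM dpP.
by case: dpP => dp1 _ _; rewrite /phip dp1 mulr0 addr0 rmorph1 expr1n.
Qed.

Definition phip_rmorph : {rmorphism S -> T} :=
  HB.pack (phip p f dp) (GRing.isZmodMorphism.Build S T _ phip_zmod)
    (GRing.isMonoidMorphism.Build S T _ phip_monoid).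

End PhipMorphism.

Section FrobeniusLift.
Variables (p : nat) (p_pr : prime p) (S T : comPzRingType).
Variables (f phi : {rmorphism S -> T}).

Lemma frobenius_congrD x y : pdvd p 1 (phi x - f x ^+ p) ->
  pdvd p 1 (phi y - f y ^+ p) -> pdvd p 1 (phi (x + y) - f (x + y) ^+ p).
Proof.
case=> u hu [v hv]; exists (u + v + Cp p (f x) (f y)).
by rewrite expr1 in hu hv *; rewrite !mulrDr -hu -hv CpE // !rmorphD; ring.
Qed.

Lemma frobenius_congrM x y : pdvd p 1 (phi x - f x ^+ p) ->
  pdvd p 1 (phi y - f y ^+ p) -> pdvd p 1 (phi (x * y) - f (x * y) ^+ p).
Proof. by move=> hx hy; rewrite !rmorphM exprMn; apply: pdvd_subM. Qed.

Variables (dp : S -> T).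
Hypothesis dpE : forall x, p%:R * dp x = phi x - f x ^+ p.
Hypothesis pI : forall x y : T, p%:R * x = p%:R * y -> x = y.

Lemma frobenius_phip x : phip p f dp x = phi x.
Proof. by rewrite /phip dpE addrC subrK. Qed.

(** Without p-torsion, a lift phi of Frobenius defines the p-derivation (phi - f^p) / p: the axioms
    may be checked after multiplication by p. *)
Lemma frobenius_p_derivation : is_p_derivation p f dp.
Proof.
split=> [|x y|x y]; apply: pI.
- by rewrite mulr0 dpE !rmorph1 expr1n subrr.
- by rewrite !mulrDr CpE // !dpE !rmorphD; ring.
- suff -> : p%:R * (f x ^+ p * dp y + f y ^+ p * dp x + p%:R * (dp x * dp y)) =
      f x ^+ p * (p%:R * dp y) + f y ^+ p * (p%:R * dp x) + (p%:R * dp x) * (p%:R * dp y).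
    by rewrite !dpE !rmorphM exprMn /=; ring.
  by ring.
Qed.

End FrobeniusLift.

(** * Dual numbers *)

(** The pair (a, b) stands for a + b eps with eps^2 = 0. A derivation along f is a ring morphism
    into T[eps] lifting f, so evaluation of polynomials also constructs derivations. *)
Definition dual (R : comPzRingType) : Type := (R * R)%type.

Section DualNumbers.
Variable R : comPzRingType.
HB.instance Definition _ := GRing.Zmodule.copy (dual R) (R * R)%type.

Definition dual_mul (u v : dual R) : dual R := (u.1 * v.1, u.1 * v.2 + v.1 * u.2).

Fact dual_mulA : associative dual_mul.
Proof.
by move=> [a b] [c d] [e g]; congr pair => /=; ring.
Qed.
Fact dual_mulC : commutative dual_mul.
Proof. by move=> [a b] [c d]; congr pair; rewrite /= 1?mulrC // addrC. Qed.
Fact dual_mul1 : left_id ((1, 0) : dual R) dual_mul.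
Proof. by move=> [a b]; congr pair; rewrite /= ?mulr0 ?addr0 mul1r. Qed.
Fact dual_mulDl : left_distributive dual_mul +%R.
Proof.
move=> [a b] [c d] [e g]; congr pair => /=; first exact: mulrDl.
by rewrite mulrDl mulrDr addrACA.
Qed.
HB.instance Definition _ := GRing.Zmodule_isComPzRing.Build (dual R)
  dual_mulA dual_mulC dual_mul1 dual_mulDl.

Definition dual_fst (u : dual R) : R := u.1.
Fact dual_fst_zmod : zmod_morphism dual_fst. Proof. by []. Qed.
Fact dual_fst_monoid : monoid_morphism dual_fst. Proof. by []. Qed.
HB.instance Definition _ := GRing.isZmodMorphism.Build (dual R) R dual_fst dual_fst_zmod.
HB.instance Definition _ := GRing.isMonoidMorphism.Build (dual R) R dual_fst dual_fst_monoid.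

End DualNumbers.

Section DualDerivation.
Variables (S T : comPzRingType) (f : {rmorphism S -> T}) (dq : S -> T).
Hypothesis dqP : is_derivation f dq.

Definition dual_lift (x : S) : dual T := (f x, dq x).

Fact dual_lift_zmod : zmod_morphism dual_lift.
Proof.
case: dqP => dqD _ x y; congr pair => /=; first by rewrite rmorphB.
by apply/eqP; rewrite eq_sym subr_eq -dqD subrK.
Qed.

Fact dual_lift_monoid : monoid_morphism dual_lift.
Proof.
case: dqP => _ dqM; split=> [|x y]; congr pair => /=.
- exact: rmorph1.
- by have := derivationX 1 0 dqP; rewrite expr0 mul0r mul0r.
- exact: rmorphM.
- exact: dqM.
Qed.

Definition dual_rmorph : {rmorphism S -> dual T} :=
  HB.pack dual_lift (GRing.isZmodMorphism.Build S (dual T) _ dual_lift_zmod)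
    (GRing.isMonoidMorphism.Build S (dual T) _ dual_lift_monoid).

End DualDerivation.

Lemma dual_snd_derivation (S T : comPzRingType) (f : {rmorphism S -> T})
    (F : {rmorphism S -> dual T}) :
  (forall x, (F x).1 = f x) -> is_derivation f (fun x => (F x).2).
Proof. by move=> F1; split=> x y; rewrite (rmorphD, rmorphM) //= !F1. Qed.

Lemma dp_derivation_phip (p : nat) (S : comPzRingType) (dp dq : S -> S) x :
    is_dp_derivation p idfun dp dq idfun dp dq ->
  dq (phip p idfun dp x) = p%:R * phip p idfun dp (dq x).
Proof.
case=> dqP dqdp; case: (dqP) => dqD _; rewrite /phip dqD (derivation_natl _ _ dqP).
by rewrite (@derivationX S S idfun _ _ _ dqP) dqdp /=; ring.
Qed.

(** Multiplied by p, the compatibility axiom between dq and dp becomes dq phi_p = p phi_p dq, a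
    condition stable under sums and products and hence testable on generators. *)
Lemma dp_derivation_of_phip (p : nat) (S : comPzRingType) (dp dq : S -> S) :
    (forall x y : S, p%:R * x = p%:R * y -> x = y) -> is_derivation idfun dq ->
    (forall x, dq (phip p idfun dp x) = p%:R * phip p idfun dp (dq x)) ->
  is_dp_derivation p idfun dp dq idfun dp dq.
Proof.
move=> pI dqP dqphi; split=> // x; apply: pI; case: (dqP) => dqD _.
have := dqphi x; rewrite /phip dqD (derivation_natl _ _ dqP).
rewrite (@derivationX S S idfun _ _ _ dqP) /= => /(canRL (addKr _)) ->.
by ring.
Qed.

(** * The universal prolongation sequence *)

Section Jets.
Variables (p : nat) (p_pr : prime p) (A : idomainType) (D : pq_structure p A).
Hypothesis p_neq0 : p%:R != 0 :> A.

Definition jet : polyring A (nat * nat)%type := free_polyring A (nat * nat)%type.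

(* The variable standing for delta_p^i delta_q^j y.                             *)
Definition jvar (i j : nat) : jet := pr_var jet (i, j).

Definition jconst : {rmorphism A -> jet} := pr_const jet.

Lemma jet_ind (K : jet -> Prop) :
    (forall c, K (jconst c)) -> (forall i j, K (jvar i j)) ->
    (forall x y, K x -> K y -> K (x + y)) ->
    (forall x y, K x -> K y -> K (x * y)) ->
  forall x, K x.
Proof. by move=> KC KX; apply: pr_ind => // -[]. Qed.

Definition jeval (S : comPzRingType) (f : {rmorphism A -> S}) (h : nat -> nat -> S) :
  {rmorphism jet -> S} := sval (pr_eval jet f (fun ij => h ij.1 ij.2)).

Lemma jevalC (S : comPzRingType) (f : {rmorphism A -> S}) h c : jeval f h (jconst c) = f c.
Proof. by rewrite /jeval; case: pr_eval => g []. Qed.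

Lemma jevalX (S : comPzRingType) (f : {rmorphism A -> S}) h i j :
  jeval f h (jvar i j) = h i j.
Proof. by rewrite /jeval; case: pr_eval => g [gC gX] /=; rewrite [LHS]gX. Qed.

Lemma jet_rmorph_ext (S : comPzRingType) (f g : {rmorphism jet -> S}) :
    (forall c, f (jconst c) = g (jconst c)) -> (forall i j, f (jvar i j) = g (jvar i j)) ->
  f =1 g.
Proof. by move=> fgC fgX; apply: pr_rmorph_ext => // -[]. Qed.

Lemma jet_natE n : n%:R = jconst n%:R :> jet.
Proof. by rewrite rmorph_nat. Qed.

Lemma jet_pI (x y : jet) : p%:R * x = p%:R * y -> x = y.
Proof.
rewrite jet_natE => e; apply: pr_ext => k; apply: (mulfI p_neq0).
by rewrite -!pr_coefCM e.
Qed.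

(** Forced by delta_p y_ij = y_(i+1)j, as phi_p x = x^p + p delta_p x. *)
Definition jphi : {rmorphism jet -> jet} :=
  jeval (jconst \o phip_rmorph p_pr (f := idfun) (pq_dpP D))
    (fun i j => jvar i j ^+ p + p%:R * jvar i.+1 j).

Lemma jphiC c : jphi (jconst c) = jconst (phip p idfun (pq_dp D) c).
Proof. exact: jevalC. Qed.

Lemma jphiX i j : jphi (jvar i j) = jvar i j ^+ p + p%:R * jvar i.+1 j.
Proof. exact: jevalX. Qed.

Lemma jphi_frobenius x : pdvd p 1 (jphi x - idfun x ^+ p).
Proof.
elim/jet_ind: x => [c|i j|x y hx hy|x y hx hy].
- rewrite /= jphiC /phip rmorphD rmorphXn addrAC subrr add0r.
  by exists (jconst (pq_dp D c)); rewrite rmorphM rmorph_nat.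
- by rewrite /= jphiX addrAC subrr add0r; exists (jvar i.+1 j).
- exact: (@frobenius_congrD p p_pr jet jet idfun jphi x y hx hy).
- exact: (@frobenius_congrM p jet jet idfun jphi x y hx hy).
Qed.

Definition jdp (x : jet) : jet := projT1 (cid (jphi_frobenius x)).

Lemma jdpE x : p%:R * jdp x = jphi x - x ^+ p.
Proof. by rewrite /jdp; case: cid => y /= ->; rewrite expr1. Qed.

Lemma jphiE x : jphi x = phip p idfun jdp x.
Proof. by rewrite (@frobenius_phip p jet jet idfun jphi jdp jdpE). Qed.

Lemma jdpP : is_p_derivation p idfun jdp.
Proof. exact: (@frobenius_p_derivation p p_pr jet jet idfun jphi jdp jdpE jet_pI). Qed.

Lemma jdpC c : jdp (jconst c) = jconst (pq_dp D c).
Proof.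
apply: jet_pI; rewrite jdpE jphiC /phip rmorphD rmorphXn addrAC subrr add0r.
by rewrite rmorphM rmorph_nat.
Qed.

Lemma jdpX i j : jdp (jvar i j) = jvar i.+1 j.
Proof. by apply: jet_pI; rewrite jdpE jphiX addrAC subrr add0r. Qed.

(* The value of delta_q on [jvar i j], forced by delta_q phi_p = p phi_p delta_q. *)
Fixpoint jdq_var (i j : nat) : jet :=
  if i is i'.+1 then jphi (jdq_var i' j) - jvar i' j ^+ p.-1 * jdq_var i' j
  else jvar 0 j.+1.

Let jconst_derivation : is_derivation jconst (jconst \o pq_dq D).
Proof.
case: (pq_dqP D) => [[dqD dqM] _].
by split=> x y; rewrite /= (dqD, dqM) (rmorphD, rmorphM) //= !rmorphM.
Qed.

Definition jdq_dual : {rmorphism jet -> dual jet} :=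
  jeval (dual_rmorph jconst_derivation) (fun i j => (jvar i j, jdq_var i j) : dual jet).

Definition jdq (x : jet) : jet := (jdq_dual x).2.

Lemma jdqC c : jdq (jconst c) = jconst (pq_dq D c).
Proof. by rewrite /jdq /jdq_dual jevalC. Qed.

Lemma jdqX i j : jdq (jvar i j) = jdq_var i j.
Proof. by rewrite /jdq /jdq_dual jevalX. Qed.

Lemma jdq_derivation : is_derivation idfun jdq.
Proof.
apply: (@dual_snd_derivation jet jet idfun jdq_dual) => x.
apply: (@jet_rmorph_ext jet (@dual_fst jet \o jdq_dual) idfun) => [c|i j].
  exact: (congr1 (@dual_fst jet) (jevalC _ _ c)).
exact: (congr1 (@dual_fst jet) (jevalX _ _ i j)).
Qed.

(** Both sides are derivations along [jphi], so generators suffice: on constants the relation holds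
    in A, and on y_ij it is the recursion defining [jdq_var]. *)
Lemma jdq_phi x : jdq (jphi x) = p%:R * jphi (jdq x).
Proof.
have [dqD dqM] := jdq_derivation.
elim/jet_ind: x => [c|i j|x y hx hy|x y hx hy].
- rewrite jphiC !jdqC jphiC (dp_derivation_phip _ (pq_dqP D)).
  by rewrite rmorphM rmorph_nat.
- rewrite jphiX dqD (derivation_natl _ _ jdq_derivation).
  rewrite (@derivationX jet jet idfun _ _ _ jdq_derivation) !jdqX /=.
  by rewrite -mulrA -mulrDr addrC subrK.
- by rewrite rmorphD !dqD rmorphD mulrDr hx hy.
- rewrite rmorphM !dqM hx hy rmorphD !rmorphM /= mulrDr.
  by congr (_ + _); rewrite mulrCA.
Qed.

Lemma jdqP : is_dp_derivation p idfun jdp jdq idfun jdp jdq.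
Proof.
apply: (@dp_derivation_of_phip p jet jdp jdq jet_pI jdq_derivation) => x.
by rewrite -!jphiE jdq_phi.
Qed.

Definition jtrunc (n : nat) : {rmorphism jet -> jet} :=
  jeval jconst (fun i j => if (i + j <= n)%N then jvar i j else 0).

Lemma jtruncC n c : jtrunc n (jconst c) = jconst c. Proof. exact: jevalC. Qed.

Lemma jtruncX n i j : jtrunc n (jvar i j) = if (i + j <= n)%N then jvar i j else 0.
Proof. exact: jevalX. Qed.

(** Polynomials in the y_ij with i + j at most n, as fixed points of a retraction: closure under
    ring operations is then immediate, and [jdp_lev] follows by cancelling p. *)
Definition jlev (n : nat) : {pred jet} := fun x => jtrunc n x == x.

Lemma jlevP n x : reflect (jtrunc n x = x) (x \in jlev n).
Proof. exact: eqP. Qed.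

Fact jlev_subring n : subring_closed (jlev n).
Proof.
split=> [|x y /jlevP hx /jlevP hy|x y /jlevP hx /jlevP hy]; apply/jlevP.
- exact: rmorph1.
- by rewrite rmorphB hx hy.
- by rewrite rmorphM hx hy.
Qed.
HB.instance Definition _ n := GRing.isSubringClosed.Build jet (jlev n) (jlev_subring n).

Lemma jlevC n c : jconst c \in jlev n.
Proof. by apply/jlevP; rewrite jtruncC. Qed.

Lemma jlevX n i j : (i + j <= n)%N -> jvar i j \in jlev n.
Proof. by move=> ijn; apply/jlevP; rewrite jtruncX ijn. Qed.

Lemma jlev_ind n (K : jet -> Prop) :
    (forall c, K (jconst c)) -> (forall i j, (i + j <= n)%N -> K (jvar i j)) ->
    (forall x y, x \in jlev n -> y \in jlev n -> K x -> K y -> K (x + y)) ->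
    (forall x y, x \in jlev n -> y \in jlev n -> K x -> K y -> K (x * y)) ->
  forall x, x \in jlev n -> K x.
Proof.
move=> KC KX KD KM x /jlevP <-.
suff [] : jtrunc n x \in jlev n /\ K (jtrunc n x) by [].
elim/jet_ind: x => [c|i j|x y [lx Kx] [ly Ky]|x y [lx Kx] [ly Ky]].
- by rewrite jtruncC; split=> //; apply: jlevC.
- rewrite jtruncX; case: leqP => [ijn|_]; first by split; [apply: jlevX | apply: KX].
  by split; [exact: rpred0 | rewrite -(rmorph0 jconst); apply: KC].
- by rewrite rmorphD; split; [exact: rpredD | exact: KD].
- by rewrite rmorphM; split; [exact: rpredM | exact: KM].
Qed.

Lemma jlevS n x : x \in jlev n -> x \in jlev n.+1.
Proof.
move: x; apply: jlev_ind => [c|i j ijn|x y _ _|x y _ _].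
- exact: jlevC.
- by apply: jlevX; apply: leqW.
- exact: rpredD.
- exact: rpredM.
Qed.

Lemma jphi_lev n x : x \in jlev n -> jphi x \in jlev n.+1.
Proof.
move: x; apply: jlev_ind => [c|i j ijn|x y _ _|x y _ _].
- by rewrite jphiC; apply: jlevC.
- rewrite jphiX; apply: rpredD; first by apply/rpredX/jlevX/leqW.
  by apply: rpredM; [exact: rpred_nat | apply: jlevX].
- by rewrite rmorphD; apply: rpredD.
- by rewrite rmorphM; apply: rpredM.
Qed.

Lemma jdp_lev n x : x \in jlev n -> jdp x \in jlev n.+1.
Proof.
move=> xn; apply/jlevP/jet_pI; rewrite -{1}(rmorph_nat (jtrunc n.+1)) -rmorphM.
rewrite jdpE rmorphB rmorphXn.
by rewrite (jlevP _ _ (jphi_lev xn)) (jlevP _ _ (jlevS xn)).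
Qed.

Lemma jdq_var_lev i j : jdq_var i j \in jlev (i + j).+1.
Proof.
elim: i => [|i IH] /=; first exact: jlevX.
rewrite addSn; apply: rpredB; first exact: jphi_lev.
by apply: rpredM; [apply/rpredX/jlevX; rewrite ltnW // ltnW | apply: jlevS].
Qed.

Lemma jlev_le m n x : (m <= n)%N -> x \in jlev m -> x \in jlev n.
Proof.
move=> mn xm; rewrite -(subnKC mn).
by elim: (n - m)%N => [|k IH]; rewrite ?addn0 // addnS; apply: jlevS.
Qed.

Lemma jdq_lev n x : x \in jlev n -> jdq x \in jlev n.+1.
Proof.
have [dqD dqM] := jdq_derivation.
move: x; apply: jlev_ind => [c|i j ijn|x y xn yn hx hy|x y xn yn hx hy].
- by rewrite jdqC; apply: jlevC.
- by rewrite jdqX; apply: jlev_le (jdq_var_lev i j).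
- by rewrite dqD; apply: rpredD.
- by rewrite dqM; apply: rpredD; apply: rpredM => //; apply: jlevS.
Qed.

Record jring (n : nat) := JRing { jval : jet; _ : jval \in jlev n }.
HB.instance Definition _ n := [isSub for @jval n].
HB.instance Definition _ n := [Choice of jring n by <:].
HB.instance Definition _ n := [SubChoice_isSubComNzRing of jring n by <:].

Lemma jvalP n (x : jring n) : jval x \in jlev n. Proof. exact: valP. Qed.

Lemma jval_inj n : injective (@jval n). Proof. exact: val_inj. Qed.

Definition jring_phi n (x : jring n) : jring n.+1 := JRing (jlevS (jvalP x)).
Definition jring_dp n (x : jring n) : jring n.+1 := JRing (jdp_lev (jvalP x)).
Definition jring_dq n (x : jring n) : jring n.+1 := JRing (jdq_lev (jvalP x)).
Definition jring_const n (a : A) : jring n := JRing (jlevC n a).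

Fact jring_phi_zmod n : zmod_morphism (@jring_phi n).
Proof. by move=> x y; apply: jval_inj. Qed.
Fact jring_phi_monoid n : monoid_morphism (@jring_phi n).
Proof. by split=> [|x y]; apply: jval_inj. Qed.
HB.instance Definition _ n :=
  GRing.isZmodMorphism.Build (jring n) (jring n.+1) (@jring_phi n) (@jring_phi_zmod n).
HB.instance Definition _ n :=
  GRing.isMonoidMorphism.Build (jring n) (jring n.+1) (@jring_phi n) (@jring_phi_monoid n).

Fact jring_const_zmod n : zmod_morphism (jring_const n).
Proof. by move=> x y; apply: jval_inj; rewrite /= rmorphB. Qed.
Fact jring_const_monoid n : monoid_morphism (jring_const n).
Proof. by split=> [|x y]; apply: jval_inj; rewrite /= (rmorph1, rmorphM). Qed.
HB.instance Definition _ n :=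
  GRing.isZmodMorphism.Build A (jring n) (jring_const n) (jring_const_zmod n).
HB.instance Definition _ n :=
  GRing.isMonoidMorphism.Build A (jring n) (jring_const n) (jring_const_monoid n).

Definition jvalr n : {rmorphism jring n -> jet} := val.

Fact jring_dpP n : is_p_derivation p (@jring_phi n) (@jring_dp n).
Proof.
have [dp1 dpD dpM] := jdpP; split=> [|x y|x y]; apply: (@jval_inj n.+1).
- exact: dp1.
- rewrite -![jval _]/(jvalr n.+1 _) !rmorphD Cp_rmorph; exact: dpD.
- rewrite -![jval _]/(jvalr n.+1 _) !rmorphD !rmorphM !rmorphXn rmorph_nat.
  exact: dpM.
Qed.

Fact jring_dqP n :
  is_dp_derivation p (@jring_phi n) (@jring_dp n) (@jring_dq n)
    (@jring_phi n.+1) (@jring_dp n.+1) (@jring_dq n.+1).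
Proof.
have [[dqD dqM] dqdp] := jdqP; split; first split.
- by move=> x y; apply: jval_inj; apply: dqD.
- by move=> x y; apply: jval_inj; apply: dqM.
move=> x; apply: (@jval_inj n.+2).
rewrite -![jval _]/(jvalr n.+2 _) !(rmorphB, rmorphD, rmorphM) !rmorphXn rmorph_nat.
exact: dqdp.
Qed.

Fact jring_dp_phi n (x : jring n) : jring_dp (jring_phi x) = jring_phi (jring_dp x).
Proof. exact: jval_inj. Qed.

Fact jring_dq_phi n (x : jring n) : jring_dq (jring_phi x) = jring_phi (jring_dq x).
Proof. exact: jval_inj. Qed.

Definition jseq : prolseq p :=
  @ProlSeq p (fun n => jring n) (fun n => @jring_phi n) jring_dp jring_dq
    jring_dpP jring_dqP jring_dp_phi jring_dq_phi.

Fact jseq_str_phi n (a : A) : jring_const n.+1 a = ps_phi (jring_const n a : jseq n).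
Proof. exact: jval_inj. Qed.
Fact jseq_str_dp n (a : A) : jring_const n.+1 (pq_dp D a) = ps_dp (jring_const n a : jseq n).
Proof. by apply: jval_inj; rewrite /= jdpC. Qed.
Fact jseq_str_dq n (a : A) : jring_const n.+1 (pq_dq D a) = ps_dq (jring_const n a : jseq n).
Proof. by apply: jval_inj; rewrite /= jdqC. Qed.

Definition jseq_over : prolseq_over D :=
  @ProlSeqOver p A D jseq (@PSMor p (const_prolseq D) jseq (fun n => jring_const n)
    jseq_str_phi jseq_str_dp jseq_str_dq).

(** * Universal property of the sequence of jets *)

Section UniversalProperty.
Variables (S : prolseq_over D) (u : S 0%N).

(* The image in [S n] of delta_p^i delta_q^j u, for [i + j <= n].               *)
Fixpoint jimg (n i j : nat) : S n :=
  match n with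
  | 0 => if (i + j == 0)%N then u else 0
  | n'.+1 =>
    if (i + j <= n')%N then ps_phi (jimg n' i j) else
    match i, j with
    | i'.+1, _ => ps_dp (jimg n' i' j)
    | 0, j'.+1 => ps_dq (jimg n' 0 j')
    | 0, 0 => 0
    end
  end.

Lemma jimg_phi n i j : (i + j <= n)%N -> jimg n.+1 i j = ps_phi (jimg n i j).
Proof. by move=> /= ->. Qed.

Lemma jimg_top n i j : (n < i + j)%N -> jimg n.+1 i j =
  match i, j with
  | i'.+1, _ => ps_dp (jimg n i' j)
  | 0, j'.+1 => ps_dq (jimg n 0 j')
  | 0, 0 => 0
  end.
Proof. by rewrite ltnNge => /negbTE /= ->. Qed.

(** Also valid where [jimg] is pushed forward from a lower level, because [ps_dp] commutes with
    [ps_phi]. *)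
Lemma jimg_dp n i j : (i + j <= n)%N -> jimg n.+1 i.+1 j = ps_dp (jimg n i j).
Proof.
elim: n => [|n IH] ijn //.
have [ijn'|] := leqP (i + j) n.
  by rewrite (@jimg_phi n.+1) ?addSn // IH // jimg_phi // ps_dp_phi.
by move=> nij; rewrite (jimg_top (i := i.+1)).
Qed.

Lemma jimg_dq n j : (j <= n)%N -> jimg n.+1 0 j.+1 = ps_dq (jimg n 0 j).
Proof.
elim: n => [|n IH] jn //.
have [jn'|] := leqP j n.
  by rewrite (@jimg_phi n.+1) ?add0n // IH // jimg_phi ?add0n // ps_dq_phi.
by move=> nj; rewrite (jimg_top (i := 0) (j := j.+1)).
Qed.

Definition jev n : {rmorphism jet -> S n} := jeval (po_str S n) (jimg n).

Lemma jevC n c : jev n (jconst c) = po_str S n c. Proof. exact: jevalC. Qed.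
Lemma jevX n i j : jev n (jvar i j) = jimg n i j. Proof. exact: jevalX. Qed.

Lemma jev_phi n x : x \in jlev n -> jev n.+1 x = ps_phi (jev n x).
Proof.
move: x; apply: jlev_ind => [c|i j ijn|x y _ _ hx hy|x y _ _ hx hy].
- by rewrite !jevC; apply: (psm_phi (po_str S)).
- by rewrite !jevX jimg_phi.
- by rewrite !rmorphD hx hy.
- by rewrite !rmorphM hx hy.
Qed.

Lemma jev_dp n x : x \in jlev n -> jev n.+1 (jdp x) = ps_dp (jev n x).
Proof.
have [_ dpD dpM] := jdpP; have [_ dpD' dpM'] := ps_dpP S n.
move: x; apply: jlev_ind => [c|i j ijn|x y xn yn hx hy|x y xn yn hx hy].
- by rewrite jdpC !jevC; apply: (psm_dp (po_str S)).
- by rewrite jdpX !jevX jimg_dp.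
- by rewrite dpD !rmorphD dpD' Cp_rmorph /= hx hy !jev_phi.
- rewrite dpM !rmorphD !rmorphM dpM' !rmorphXn rmorph_nat /=.
  by rewrite hx hy !jev_phi.
Qed.

(** The axiom of S reads delta_q delta_p x = phi_p (delta_q x) - x^(p-1) delta_q x, which is the
    recursion for [jdq_var]. *)
Lemma jev_dq_var n i j : (i + j <= n)%N -> jev n.+1 (jdq_var i j) = ps_dq (jimg n i j).
Proof.
elim: i n => [|i IH] n ijn /=; first by rewrite jevX jimg_dq.
case: n ijn => // n; rewrite addSn ltnS => ijn.
have d_lev : jdq_var i j \in jlev n.+1 by apply: jlev_le (jdq_var_lev i j).
have y_lev : jvar i j \in jlev n by apply: jlevX.
rewrite jimg_dp //; have [_ ->] := ps_dqP S n.
rewrite jphiE /phip rmorphB rmorphD !rmorphM !rmorphXn rmorph_nat /=.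
rewrite jev_dp // !(jev_phi d_lev) IH // (jev_phi (jlevS y_lev)) (jev_phi y_lev) jevX.
by congr (_ - _); rewrite addrC.
Qed.

Lemma jev_dq n x : x \in jlev n -> jev n.+1 (jdq x) = ps_dq (jev n x).
Proof.
have [dqD dqM] := jdq_derivation; have [[dqD' dqM'] _] := ps_dqP S n.
move: x; apply: jlev_ind => [c|i j ijn|x y xn yn hx hy|x y xn yn hx hy].
- by rewrite jdqC !jevC; apply: (psm_dq (po_str S)).
- by rewrite jdqX jevX jev_dq_var.
- by rewrite dqD !rmorphD dqD' hx hy.
- by rewrite dqM !rmorphD !rmorphM dqM' hx hy /= !jev_phi.
Qed.

Definition jseq_mor : ps_mor jseq S :=
  @PSMor p jseq S (fun n => jev n \o jvalr n) (fun n x => jev_phi (jvalP x))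
    (fun n x => jev_dp (jvalP x)) (fun n x => jev_dq (jvalP x)).

Definition jseq_mor_over : ps_mor_over jseq_over S :=
  @PSMorOver p A D jseq_over S jseq_mor jevC.

Lemma jseq_morE n (x : jring n) : jseq_mor_over n x = jev n (jval x).
Proof. by []. Qed.

End UniversalProperty.

(** * Linear forms on the universal sequence *)

(** This is phi_p^i delta_q^j y in the universal sequence. *)
Definition jz (i j : nat) : jet := iter i jphi (jvar 0 j).

Lemma jz_lev i j : jz i j \in jlev (i + j).
Proof. by elim: i => [|i IH]; [apply: jlevX | apply: jphi_lev]. Qed.

Lemma jvarXp_fil d i j : (d <= p)%N -> fil d (jvar i j ^+ p).
Proof. by move=> dp; apply: (fil_le _ dp); apply/filX/fil1_var. Qed.

Lemma jphi_fil d x : fil d x -> fil d (jphi x).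
Proof.
apply: (fil_rmorph (s := phip p idfun (pq_dp D))) => [c|[i j]]; first exact: jphiC.
rewrite [jphi _]jphiX; apply: filD; last exact/filMnat/fil1_var.
exact/jvarXp_fil/prime_gt0.
Qed.

(** Modulo degree 2 the term y_ij^p disappears, so each application of [jphi] sends y_ij to p
    y_(i+1)j. *)
Lemma jz_linear i j : fil 2 (jz i j - (p ^ i)%:R * jvar i j).
Proof.
elim: i => [|i IH]; first by rewrite expn0 mul1r subrr; apply: fil0.
rewrite /= -[jz i j](subrK ((p ^ i)%:R * jvar i j)) rmorphD rmorphM rmorph_nat jphiX.
rewrite expnSr natrM -addrA; apply: filD; first exact: jphi_fil.
rewrite mulrDr mulrA addrK; apply: filMnat.
exact/jvarXp_fil/prime_gt1.
Qed.

Lemma coef_jz i j a b :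
  pr_coef jet (ucm (a, b)) (jz i j) = (p ^ i)%:R * ((a, b) == (i, j))%:R.
Proof.
rewrite -[jz i j](subrK ((p ^ i)%:R * jvar i j)) raddfD /= jz_linear ?mdegU // add0r.
rewrite pr_natE pr_coefCM pr_coef_mon; congr (_ * (_ : bool)%:R).
apply/eqP/eqP => [|-> //] /(congr1 (fun m : {cmonom _} => m (i, j))).
by rewrite !cmU eqxx; case: eqP.
Qed.

Lemma coef_jlev n x a b : (n < a + b)%N -> x \in jlev n ->
  pr_coef jet (ucm (a, b)) x = 0.
Proof.
move=> nab; move: x; apply: jlev_ind => [c|i j ijn|x y _ _ hx hy|x y _ _ hx hy].
- by rewrite pr_coefCE cm1_eq1 mulr0.
- rewrite -[jvar i j]mul1r -(rmorph1 jconst) pr_coefCM pr_coef_mon mul1r.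
  case: eqP => // /(congr1 (fun m : {cmonom _} => m (i, j))).
  by rewrite !cmU eqxx; case: eqP => // -[ai bj]; move: nab; rewrite ai bj ltnNge ijn.
- by rewrite raddfD /= hx hy addr0.
- by rewrite pr_coef_linM hx hy !mulr0 addr0.
Qed.

Lemma jz_frobenius i j : pdvd p 1 (jz i j - jvar 0 j ^+ (p ^ i)).
Proof.
elim: i => [|i IH]; first by rewrite expn0 expr1 subrr; apply: pdvd0.
rewrite expnSr exprM /=; apply: pdvd_subtrans (jphi_frobenius (jz i j)) _.
exact: pdvd_subX.
Qed.

Definition mexp (i : nat * nat) (n : nat) : {cmonom (nat * nat)%type} :=
  iter n (fun k => ucm i * k)%M 1%M.

Lemma mexpE i n j : mexp i n j = (n * (i == j))%N.
Proof. by elim: n => [|n IH]; rewrite ?cm1 //= cmM IH cmU mulSn. Qed.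

Lemma jvarX i j n : jvar i j ^+ n = pr_mon jet (mexp (i, j) n).
Proof.
by elim: n => [|n IH]; rewrite ?pr_mon1 // exprS IH -pr_monM.
Qed.

(** As p^i is positive, the monomial shows which y_0j it contains, and its degree then gives i. *)
Lemma mexp_inj i j a b : mexp (0%N, j) (p ^ i) = mexp (0%N, b) (p ^ a) -> (i, j) = (a, b).
Proof.
move=> /(congr1 (fun m : {cmonom _} => m (0%N, j))); rewrite !mexpE eqxx muln1.
case: eqP => [[->]|_]; last first.
  by rewrite muln0 => /eqP; rewrite expn_eq0 eqn0Ngt prime_gt0.
by rewrite muln1 => /eqP; rewrite eqn_exp2l ?prime_gt1 // => /eqP ->.
Qed.

Section LinearForms.
Variable r : nat.
Local Notation T := {ij : 'I_r.+1 * 'I_r.+1 | (ij.1 + ij.2 <= r)%N}.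
Implicit Types (t : T) (c : T -> A).

Definition jform c : jet :=
  \sum_(t : T) jconst (c t) * jz (val t).1 (val t).2.

Lemma jform_lev c : jform c \in jlev r.
Proof.
apply: rpred_sum => t _; apply: rpredM; first exact: jlevC.
exact: jlev_le (valP t) (jz_lev _ _).
Qed.

Lemma bidegree_eq t t' :
  (((val t).1 : nat, (val t).2 : nat) == ((val t').1 : nat, (val t').2 : nat)) = (t == t').
Proof.
rewrite -(inj_eq val_inj); case: (val t) (val t') => [i j] [i' j'] /=.
by rewrite !xpair_eqE.
Qed.

Lemma coef_jform c t : pr_coef jet (ucm ((val t).1 : nat, (val t).2 : nat)) (jform c) =
  (p ^ (val t).1)%:R * c t.
Proof.
rewrite /jform raddf_sum (bigD1 t) //= big1 => [|t' t't].
  by rewrite pr_coefCM coef_jz bidegree_eq eqxx mulr1 addr0 mulrC.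
by rewrite pr_coefCM coef_jz bidegree_eq eq_sym (negbTE t't) !mulr0.
Qed.

(** Modulo p the generators become distinct monomials, so each c t is itself a coefficient of the
    form. *)
Lemma jform_modp c : pdvd p 1 (jform c) -> forall t, pdvd p 1 (c t).
Proof.
move=> hc t; pose F := \sum_(t : T) jconst (c t) * jvar 0 (val t).2 ^+ (p ^ (val t).1).
have /pdvd_coefP/(_ (mexp (0%N, (val t).2 : nat) (p ^ (val t).1))) : pdvd p 1 F.
  rewrite -[F](subKr (jform c)); apply: pdvdB => //; rewrite -sumrB.
  by apply: pdvd_sum => t' _; rewrite -mulrBr; apply/pdvdMl/jz_frobenius.
rewrite /F raddf_sum (bigD1 t) //= big1 => [|t' t't].
  by rewrite jvarX pr_coefCM pr_coef_mon eqxx mulr1 addr0.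
rewrite jvarX pr_coefCM pr_coef_mon; case: eqP => [/mexp_inj/eqP|_]; last by rewrite mulr0.
by rewrite bidegree_eq eq_sym (negbTE t't).
Qed.

Lemma base_pI (a b : A) : p%:R * a = p%:R * b -> a = b.
Proof. exact: mulfI. Qed.

Lemma base_separated (hA : padic_complete p A) m (a : A) :
  (forall n, pdvd p n ((p ^ m)%:R * a)) -> a = 0.
Proof.
move=> h; apply: hA.1 => n; apply: (pdvd_cancel base_pI (m := m)).
by rewrite -natrX; apply: h.
Qed.

Lemma jform_inj (hA : padic_complete p A) c : (forall n, pdvd p n (jform c)) -> forall t, c t = 0.
Proof.
move=> hc t; apply: (base_separated hA (m := (val t).1)) => n.
by rewrite -coef_jform; have /pdvd_coefP := hc n.
Qed.

(* The endomorphism induced by y |-> 2 y.                                       *)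
Definition jdbl : {rmorphism jet -> jet} :=
  jeval jconst (fun i j => iter i jdp (2%:R * jvar 0 j)).

Lemma jdblC (a : A) : jdbl (jconst a) = jconst a. Proof. exact: jevalC. Qed.

Lemma jdblX i j : jdbl (jvar i j) = iter i jdp (2%:R * jvar 0 j).
Proof. exact: jevalX. Qed.

(** After multiplication by p the difference is 2 y_ij^p plus [jphi] of the error at i minus x^p,
    all of degree at least 2; p is then cancelled in the coefficients. *)
Lemma jdbl_fil i j : fil 2 (jdbl (jvar i j) - 2%:R * jvar i j).
Proof.
rewrite jdblX; elim: i => [|i IH] /=; first by rewrite subrr; apply: fil0.
set x := iter i _ _ in IH *; set h := x - _ in IH.
have p_gt1 := prime_gt1 p_pr.
have e : p%:R * (jdp x - 2%:R * jvar i.+1 j) = 2%:R * jvar i j ^+ p + jphi h - x ^+ p.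
  rewrite mulrBr jdpE /h rmorphB rmorphM rmorph_nat jphiX; ring.
have x1 : fil 1 x.
  rewrite -[x](subrK (2%:R * jvar i j)); apply: filD; first exact: (fil_le IH).
  exact/filMnat/fil1_var.
have : fil 2 (p%:R * (jdp x - 2%:R * jvar i.+1 j)).
  rewrite e; apply: filB; last by apply: (fil_le _ p_gt1); apply: filX.
  apply: filD; last exact: jphi_fil.
  exact/filMnat/jvarXp_fil.
move=> hp k kd; have := hp k kd; rewrite (pr_natE jet) pr_coefCM => /eqP.
by rewrite mulf_eq0 (negbTE p_neq0) => /eqP.
Qed.

Lemma jdbl_phi x : jdbl (jphi x) = jphi (jdbl x).
Proof.
apply: (@jet_rmorph_ext jet (jdbl \o jphi) (jphi \o jdbl)) => [a|i j] /=.
  by rewrite jphiC !jdblC jphiC.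
rewrite jphiX rmorphD rmorphM rmorphXn rmorph_nat !jdblX /= jdpE.
by rewrite addrC subrK.
Qed.

Lemma jdbl_z i j : jdbl (jz i j) = 2%:R * jz i j.
Proof.
elim: i => [|i IH]; first by rewrite jdblX.
by rewrite /= jdbl_phi IH rmorphM rmorph_nat.
Qed.

Lemma jdbl_form c : jdbl (jform c) = 2%:R * jform c.
Proof.
rewrite rmorph_sum mulr_sumr; apply: eq_bigr => t _.
by rewrite rmorphM jdblC jdbl_z mulrCA.
Qed.

(* Comparing linear parts writes [p ^ r *: g] as a form, whose coefficients are *)
(* then divided by p one power at a time.                                       *)
Lemma doubling_form (hA : padic_complete p A) (g : nat -> jet) :
    (forall n, g n \in jlev r) ->
    (forall n, pdvd p n (g n.+1 - g n)) ->
    (forall n, pdvd p n (jdbl (g n) - 2%:R * g n)) ->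
  exists c, forall n, pdvd p n (g n - jform c).
Proof.
move=> g_lev g_cauchy g_dbl.
have lim_coef t : {a : A | forall n,
    pdvd p n (a - pr_coef jet (ucm ((val t).1 : nat, (val t).2 : nat)) (g n))}.
  apply/cid/hA.2 => n; rewrite -raddfB.
  by have /pdvd_coefP := g_cauchy n; apply.
(* The linear coefficient of [jform c] at (i, j) is p^i c t, so this factor makes it p^r times the
   limit. *)
pose c t := (p ^ (r - (val t).1))%:R * sval (lim_coef t).
have form_p : forall n, pdvd p n ((p ^ r)%:R * g n - jform c).
  apply: (dbl_rigid p_pr base_pI jdblC) => [[i j]|n|n|n [a b]]; first exact: jdbl_fil.
  - by rewrite opprB addrA subrK -mulrBr; apply: pdvdMl.
  - have -> : jdbl ((p ^ r)%:R * g n - jform c) - 2%:R * ((p ^ r)%:R * g n - jform c)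
        = (p ^ r)%:R * (jdbl (g n) - 2%:R * g n).
      by rewrite rmorphB rmorphM rmorph_nat jdbl_form; ring.
    exact: pdvdMl.
  - have [abr|abr] := leqP (a + b) r; last first.
      by rewrite (coef_jlev abr) ?rpredB ?rpredM ?rpred_nat ?jform_lev //; apply: pdvd0.
    have [ar br] : (a < r.+1)%N /\ (b < r.+1)%N.
      by rewrite !ltnS; split; apply: leq_trans abr; rewrite ?leq_addr ?leq_addl.
    pose t : T := exist _ (Ordinal ar, Ordinal br) abr.
    have := coef_jform c t; rewrite /= raddfB (pr_natE jet) pr_coefCM => ->.
    rewrite /c mulrA -natrM -expnD subnKC // -mulrBr; apply/pdvdMl/pdvd_subC.
    exact: (svalP (lim_coef t)).
have : exists c, forall n, pdvd p n ((p ^ r)%:R * g n - jform c) by exists c.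
(* The exponent of p in front of g is lowered by one at a time, the coefficients c changing with
   it. *)
elim: (r in (p ^ r)%N) => [|s IH] in c {form_p} *.
  by case=> {}c hc; exists c => n; move: (hc n); rewrite mul1r.
case=> {}c hc; apply: IH.
(* At precision 1 the form is congruent to p^(s+1) g 1, hence to 0, modulo p. *)
have c_p t : pdvd p 1 (c t).
  apply: jform_modp; rewrite -[jform c](subKr ((p ^ s.+1)%:R * g 1%N)).
  apply: pdvdB (hc 1%N); rewrite expnS natrM -mulrA; exact: pdvdE.
pose c' t := sval (cid (c_p t)).
have cE t : c t = p%:R * c' t by rewrite /c'; case: cid.
exists c' => n; have e : jform c = p%:R * jform c'.
  rewrite mulr_sumr; apply: eq_bigr => t _.
  by rewrite cE rmorphM rmorph_nat mulrA.
(* Cancelling p costs one power, so precision n + 1 is used and g (n + 1) is then replaced by g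
   n. *)
have := hc n.+1; rewrite e expnS natrM -mulrA -mulrBr -[X in X * _]expr1 -add1n.
move=> /(pdvd_cancel jet_pI) h; apply: pdvd_subtrans h.
by rewrite -mulrBr; apply/pdvdMl/pdvd_subC/g_cauchy.
Qed.

End LinearForms.

(** * Characters as linear forms *)

Definition jgen : jseq_over 0%N := JRing (@jlevX 0 0 0 isT).

Lemma jimg_gen (S : prolseq_over D) (u : S 0%N) : jseq_mor_over u 0%N jgen = u.
Proof. by rewrite jseq_morE jevX. Qed.

(** Constants and y generate the universal sequence under the ring operations, phi, delta_p and
    delta_q, all of which g respects. *)
Lemma jseq_mor_unique (S : prolseq_over D) (g : ps_mor_over jseq_over S) n (x : jseq_over n) :
  g n x = jseq_mor_over (g 0%N jgen) n x.
Proof.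
rewrite jseq_morE; case: x => /= x; set u := g 0%N jgen.
have img i j (yP : jvar i j \in jlev n) : (i + j <= n)%N -> g n (JRing yP) = jimg u n i j.
  elim: n i j yP => [|n IH] i j yP.
    rewrite leqn0 addn_eq0 => /andP[/eqP i0 /eqP j0]; subst i j; congr (g _ _).
    exact: jval_inj.
  rewrite leq_eqVlt => /predU1P[ij|]; last first.
    rewrite ltnS => ij; rewrite jimg_phi // -(IH _ _ (jlevX ij) ij) -[RHS](psm_phi g).
    by congr (g _ _); apply: jval_inj.
  rewrite jimg_top ?ij //; case: i ij yP => [|i] ij yP.
    case: j ij yP => // j [jn] yP; have jn' : (0 + j <= n)%N by rewrite add0n -jn.
    rewrite -(IH _ _ (jlevX jn') jn') -[RHS](psm_dq g); congr (g _ _); apply: jval_inj.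
    by rewrite /= jdqX.
  have ij' : (i + j <= n)%N by rewrite -ltnS -ij addSn.
  rewrite -(IH _ _ (jlevX ij') ij') -[RHS](psm_dp g); congr (g _ _); apply: jval_inj.
  by rewrite /= jdpX.
(* The membership proof is duplicated: one copy drives the induction, the other stays universally
   quantified inside [JRing]. *)
move=> xP; move: x xP (xP); apply: jlev_ind => [c|i j ij|x y xP yP hx hy|x y xP yP hx hy] zP.
- by rewrite jevC -(pmo_str g); congr (g _ _); apply: jval_inj.
- by rewrite jevX img.
- rewrite rmorphD -(hx xP) -(hy yP) -rmorphD; congr (g _ _); exact: jval_inj.
- rewrite rmorphM -(hx xP) -(hy yP) -rmorphM; congr (g _ _); exact: jval_inj.
Qed.

Lemma jseq_mor_comp (S T : prolseq_over D) (g : ps_mor_over S T) (u : S 0%N) n x :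
  g n (jseq_mor_over u n x) = jseq_mor_over (g 0%N u) n x.
Proof.
rewrite -[in RHS](jimg_gen u).
exact: (jseq_mor_unique (ps_comp_over g (jseq_mor_over u))).
Qed.

(** Identifies [jdbl] with the morphism of sequences y |-> y + y, to which additivity of a character
    applies. *)
Lemma jval_jdbl n (x : jring n) :
  jval (jseq_mor_over (jgen + jgen) n x : jring n) = jdbl (jval x).
Proof.
rewrite jseq_morE; case: x => /= x; set u : jseq_over 0%N := (_ + _).
have img i j : (i + j <= n)%N ->
    jval (@jimg jseq_over u n i j : jring n) = iter i jdp (2%:R * jvar 0 j).
  elim: n i j => [|n IH] i j.
    by rewrite leqn0 addn_eq0 => /andP[/eqP-> /eqP->] /=; rewrite mulr_natl mulr2n.
  rewrite leq_eqVlt => /predU1P[ij|]; last first.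
    by rewrite ltnS => ij; rewrite jimg_phi //=; apply: IH.
  rewrite jimg_top ?ij //; case: i ij => [|i] ij /=.
    case: j ij => // j [jn]; have /= -> := IH 0%N j; last by rewrite -jn.
    by rewrite (derivation_natl _ _ jdq_derivation) jdqX.
  by rewrite IH // -ltnS -ij addSn.
move: x; apply: jlev_ind => [c|i j ij|x y _ _ hx hy|x y _ _ hx hy].
- by rewrite jevC jdblC.
- by rewrite jevX img // jdblX.
- by rewrite !rmorphD -hx -hy.
- by rewrite !rmorphM -hx -hy.
Qed.

Local Notation tmor := (trunc_mor_over p_pr).

Lemma trunc_mor_overP (S : prolseq_over D) N n (x y : S n) :
  tmor S N n x = tmor S N n y <-> pdvd p (N - n) (x - y).
Proof. exact: trunc_piP. Qed.

Section CharacterForm.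
Variables (r : nat) (f : character D r).

(** x lifts the value of f at y. Truncation at n + r leaves level r modulo p^n. *)
Definition ch_repr n (x : jseq_over r) : Prop :=
  f _ (trunc_over_complete p_pr jseq_over (n + r)) (tmor jseq_over (n + r) 0%N jgen) =
  tmor jseq_over (n + r) r x.

Lemma ch_repr_ex n : exists x, ch_repr n x.
Proof.
rewrite /ch_repr; move: (f _ _ _) => q; exists (pquot_repr q).
exact: esym (pquot_reprK q).
Qed.

(** The morphism y |-> u factors through the truncation, and naturality carries the value at y to
    the value at u. *)
Lemma ch_repr_nilpotent n x (S : prolseq_over D) (hS : ps_complete S) (u : S 0%N) :
    (forall k, p%:R ^+ (n + r - k) = 0 :> S k) -> ch_repr n x ->
  f S hS u = jseq_mor_over u r x.
Proof.
move=> S0 fx; pose h := trunc_lift_over p_pr (jseq_mor_over u) S0.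
have hE k (y : jseq_over k) : h k (tmor jseq_over (n + r) k y) = jseq_mor_over u k y.
  exact: trunc_liftE.
have := ch_nat f (trunc_over_complete p_pr jseq_over (n + r)) hS h
  (tmor jseq_over (n + r) 0%N jgen).
by rewrite fx !hE jimg_gen.
Qed.

(** Naturality along the projection of S to its truncation reduces this to the nilpotent case. *)
Lemma ch_repr_eval n x (S : prolseq_over D) (hS : ps_complete S) (u : S 0%N) :
  ch_repr n x -> pdvd p n (f S hS u - jseq_mor_over u r x).
Proof.
move=> fx; rewrite -{1}(addnK r n); apply/trunc_mor_overP.
rewrite jseq_mor_comp (ch_nat f hS (trunc_over_complete p_pr S (n + r))).
exact: (ch_repr_nilpotent _ _ (trunc_over_nilpotent p_pr S (n + r))).
Qed.

Lemma jval_pdvdB n k (x y : jseq_over n) : pdvd p k (x - y) -> pdvd p k (jval x - jval y).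
Proof. by move/(pdvd_rmorph (jvalr n)); rewrite rmorphB. Qed.

(** The truncation at n + r also satisfies the nilpotency condition for n + 1, so x' computes f
    there as well. *)
Lemma ch_repr_cauchy n x x' : ch_repr n x -> ch_repr n.+1 x' -> pdvd p n (jval x' - jval x).
Proof.
move=> fx fx'; apply: jval_pdvdB; rewrite -(addnK r n); apply/trunc_mor_overP.
rewrite -fx jseq_mor_unique; apply: esym; apply: ch_repr_nilpotent fx' => k.
apply: expr_eq0_le (trunc_over_nilpotent p_pr jseq_over (n + r) k).
exact/leq_sub2r/leqW.
Qed.

Lemma ch_repr_dbl n x : ch_repr n x -> pdvd p n (jdbl (jval x) - 2%:R * jval x).
Proof.
move=> fx; rewrite -jval_jdbl mulr_natl mulr2n -[jval x + _](rmorphD (jvalr r)).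
apply: jval_pdvdB.
rewrite -{1}(addnK r n); apply/trunc_mor_overP.
rewrite rmorphD -{1 2}fx -ch_add jseq_mor_comp rmorphD; apply: esym.
exact: (ch_repr_nilpotent _ _ (trunc_over_nilpotent p_pr jseq_over (n + r))).
Qed.

Lemma ch_repr_form (hA : padic_complete p A) :
  exists c, forall n x, ch_repr n x -> pdvd p n (jval x - jform (r := r) c).
Proof.
pose g n := sval (cid (ch_repr_ex n)); have gP n : ch_repr n (g n) by rewrite /g; case: cid.
have [|n|n|c hc] := @doubling_form r hA (fun n => jval (g n)).
- by move=> n; apply: jvalP.
- exact: ch_repr_cauchy (gP n) (gP n.+1).
- exact: ch_repr_dbl (gP n).
exists c => n x fx; apply: pdvd_subtrans (hc n).
(* Two lifts x and g n at the same precision are compared through g (n + 1). *)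
rewrite -(subrKA (jval (g n.+1))); apply: pdvdD; last exact: ch_repr_cauchy.
by apply/pdvd_subC; apply: ch_repr_cauchy.
Qed.

End CharacterForm.

(** * Evaluation of the generators and the basis in order r *)

Lemma dq_iterE j (S : prolseq_over D) (hS : ps_complete S) u :
  dq_iter D j S hS u = jev u j (jvar 0 j).
Proof.
elim: j => [|j IH] /=; first by rewrite jevX.
by rewrite IH -(jev_dq _ (jlevX (leqnn (0 + j)))) jdqX.
Qed.

Lemma phi_dq_iterE i j (S : prolseq_over D) (hS : ps_complete S) u :
  phi_dq_iter p_pr D i j S hS u = jev u (i + j) (jz i j).
Proof.
elim: i => [|i IH] /=; first exact: dq_iterE.
rewrite jphiE /phip IH rmorphD rmorphM rmorphXn rmorph_nat /=.
by rewrite (jev_phi _ (jz_lev i j)) (jev_dp _ (jz_lev i j)).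
Qed.

Lemma ch_transE m n (f : Xr D m) x (S : prolseq_over D) (hS : ps_complete S) u :
    (m <= n)%N -> x \in jlev m -> ch_fun f hS u = jev u m x ->
  ch_fun (trans (V := Xr D) (@ch_up p A D) n f : Xr D n) hS u = jev u n x.
Proof.
move=> mn xm fx; elim: n mn => [|n IH] mn.
  by move: mn; rewrite leqn0 => /eqP m0; subst m; rewrite transnn.
move: mn; rewrite leq_eqVlt => /predU1P[mn|]; first by subst m; rewrite transnn.
rewrite ltnS => mn; rewrite transS //= IH // -jev_phi //.
exact: jlev_le xm.
Qed.

Section Basis.
Variable r : nat.
Local Notation T := {ij : 'I_r.+1 * 'I_r.+1 | (ij.1 + ij.2 <= r)%N}.
Implicit Types (t : T) (c : T -> A).

Definition ch_form c : Xr D r :=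
  \big[@lm_add A (Xr D r) / lm_zero]_(t : T)
    (c t *: phi_dq_y p_pr D r (val t).1 (val t).2)%LM.

Lemma ch_formE c (S : prolseq_over D) (hS : ps_complete S) u :
  ch_fun (ch_form c) hS u = jev u r (jform c).
Proof.
rewrite /ch_form /jform rmorph_sum; elim/big_rec2: _ => [//|t y f _ <-] /=.
rewrite rmorphM jevC; congr (_ * _ + _).
exact: ch_transE (valP t) (jz_lev _ _) (phi_dq_iterE _ _ _ _).
Qed.

(** It suffices to evaluate at y in the truncations at n + N of the universal sequence, for all n.
    Levels N above r serve the direct limit. *)
Lemma jform_eval_inj (hA : padic_complete p A) N c : (r <= N)%N ->
    (forall (S : prolseq_over D) (hS : ps_complete S) (u : S 0%N), jev u N (jform c) = 0) ->
  forall t, c t = 0.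
Proof.
move=> rN c0; apply: (jform_inj hA) => n.
have xN : jform c \in jlev N by apply: jlev_le rN (jform_lev c).
have := c0 _ (trunc_over_complete p_pr jseq_over (n + N)) (tmor jseq_over (n + N) 0%N jgen).
rewrite -[jev _ _ _]/(jseq_mor_over _ N (JRing xN : jseq_over N)) -jseq_mor_unique.
rewrite -(rmorph0 (tmor jseq_over (n + N) N)) => /trunc_mor_overP.
by rewrite addnK subr0 => /(pdvd_rmorph (jvalr N)).
Qed.

Lemma jformB c c' : jform (fun t => c t - c' t) = jform c - jform c'.
Proof. by rewrite -sumrB; apply: eq_bigr => t _; rewrite rmorphB mulrBl. Qed.

Lemma ch_form_inj (hA : padic_complete p A) c c' : ch_form c = ch_form c' -> c =1 c'.
Proof.
move=> cc' t; apply/eqP; rewrite -subr_eq0; apply/eqP; move: t.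
apply: (jform_eval_inj hA (leqnn r)) => S hS u.
by rewrite jformB rmorphB -!(ch_formE _ hS) cc' subrr.
Qed.

(** f and the form agree at u modulo every p^n, and S r is p-adically separated. *)
Lemma ch_form_surj (hA : padic_complete p A) (f : Xr D r) : exists c, f = ch_form c.
Proof.
have [c hc] := ch_repr_form f hA; exists c; apply: character_eq => S hS u.
rewrite ch_formE; apply/eqP; rewrite -subr_eq0; apply/eqP/(hS r).1 => n.
have [x fx] := ch_repr_ex f n; rewrite -(subrKA (jseq_mor_over u r x)).
apply: pdvdD; first exact: ch_repr_eval.
by rewrite jseq_morE -rmorphB; apply/pdvd_rmorph/hc.
Qed.

Lemma phi_dq_y_basis (hA : padic_complete p A) :
  is_basis (fun ij : T => phi_dq_y p_pr D r (val ij).1 (val ij).2).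
Proof.
move=> f; have [c ->] := ch_form_surj hA f; exists (finfun c); split.
  by apply: eq_bigr => t _; rewrite ffunE.
move=> c' e; apply/ffunP => t; rewrite ffunE; exact: ch_form_inj e t.
Qed.

End Basis.
(** * The module of all characters *)

Local Notation pqR := (pqring D).
Local Notation PhiD i j := (pqpi D (TPhi A) ^+ i * pqpi D (TDelta A) ^+ j : pqR).

Definition pqC (a : A) : pqR := pqpi D (TConst a).

Fact pqC_zmod : zmod_morphism pqC.
Proof.
move=> a b; apply/eqP; rewrite eq_sym subr_eq -pqpiD; apply/eqP/pqpiP.
by rewrite -[in TConst a](subrK b a); apply: pqeq_constD.
Qed.
Fact pqC_monoid : monoid_morphism pqC.
Proof. by split=> // a b; rewrite -pqpiM; apply/pqpiP/pqeq_constM. Qed.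
HB.instance Definition _ := GRing.isZmodMorphism.Build A pqR pqC pqC_zmod.
HB.instance Definition _ := GRing.isMonoidMorphism.Build A pqR pqC pqC_monoid.

Lemma pqPhiC a : pqpi D (TPhi A) * pqC a = pqC (phip p idfun (pq_dp D) a) * pqpi D (TPhi A).
Proof. by rewrite -!pqpiM; apply/pqpiP/pqeq_phi. Qed.

Lemma pqDeltaC a : pqpi D (TDelta A) * pqC a =
  pqC a * pqpi D (TDelta A) + pqC (pq_dq D a).
Proof.
apply/eqP; rewrite addrC -subr_eq -!pqpiM -pqpiN -pqpiD.
by apply/eqP/pqpiP/pqeq_delta.
Qed.

Lemma pqDeltaPhi i : pqpi D (TDelta A) * pqpi D (TPhi A) ^+ i =
  pqC (p ^ i)%:R * (pqpi D (TPhi A) ^+ i * pqpi D (TDelta A)).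
Proof.
elim: i => [|i IH]; first by rewrite !expr0 mulr1 mul1r rmorph1 mul1r.
have DP : pqpi D (TDelta A) * pqpi D (TPhi A) =
    pqC p%:R * (pqpi D (TPhi A) * pqpi D (TDelta A)).
  by rewrite -!pqpiM; apply/pqpiP/pqeq_delta_phi.
rewrite exprS mulrA DP -!mulrA IH !rmorph_nat expnS natrM -!mulrA; congr (_ * _).
by rewrite mulrA (commr_nat (pqpi D (TPhi A)) (p ^ i)) -mulrA.
Qed.

Definition pqterms (s : seq (A * (nat * nat))) : pqR :=
  \sum_(t <- s) pqC t.1 * PhiD t.2.1 t.2.2.

(** Normal ordering: constants move to the left and delta_q to the right of phi_p, so these sums
    absorb left multiplication by any word. *)
Lemma pqterms_mul (w : pqterm A) s : exists s', pqpi D w * pqterms s = pqterms s'.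
Proof.
elim: w s => [a|||w IH|w IHw v IHv|w IHw v IHv] s.
- exists [seq (a * t.1, t.2) | t <- s].
  rewrite /pqterms big_map mulr_sumr; apply: eq_bigr => t _ /=.
  by rewrite rmorphM mulrA.
- exists [seq (phip p idfun (pq_dp D) t.1, (t.2.1.+1, t.2.2)) | t <- s].
  rewrite /pqterms big_map mulr_sumr; apply: eq_bigr => t _ /=.
  by rewrite mulrA pqPhiC exprS !mulrA.
- exists ([seq (t.1 * (p ^ t.2.1)%:R, (t.2.1, t.2.2.+1)) | t <- s] ++
          [seq (pq_dq D t.1, t.2) | t <- s]).
  rewrite /pqterms big_cat !big_map mulr_sumr /= -big_split; apply: eq_bigr => t _ /=.
  rewrite mulrA pqDeltaC mulrDl; congr (_ + _).
  by rewrite -mulrA [_ * (_ ^+ _ * _)]mulrA pqDeltaPhi rmorphM exprS !mulrA.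
- have [s' e] := IH s; exists [seq (- t.1, t.2) | t <- s'].
  rewrite pqpiN mulNr e /pqterms big_map -sumrN; apply: eq_bigr => t _ /=.
  by rewrite rmorphN mulNr.
- have [s1 e1] := IHw s; have [s2 e2] := IHv s; exists (s1 ++ s2).
  by rewrite pqpiD mulrDl e1 e2 /pqterms big_cat.
- have [s1 e1] := IHv s; have [s2 e2] := IHw s1; exists s2.
  by rewrite pqpiM -mulrA e1.
Qed.

Lemma pqterms_surj (P : pqR) : exists s, P = pqterms s.
Proof.
elim/pqring_ind: P => w; have [s' e] := pqterms_mul w [:: (1, (0%N, 0%N))]; exists s'.
by rewrite -e /pqterms big_seq1 /= rmorph1 !mulr1.
Qed.

Local Notation T r := {ij : 'I_r.+1 * 'I_r.+1 | (ij.1 + ij.2 <= r)%N}.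

Definition pqform r (c : T r -> A) : pqR :=
  \sum_(t : T r) pqC (c t) * PhiD (val t).1 (val t).2.

Lemma pqform_surj (P : pqR) : exists r c, P = @pqform r c.
Proof.
have [s ->] := pqterms_surj P; pose r := (\max_(x <- s) (x.2.1 + x.2.2))%N.
pose pos (t : T r) : nat * nat := ((val t).1 : nat, (val t).2 : nat).
(* Coefficients of equal bidegree are added; r bounds every i + j that occurs. *)
exists r, (fun t => \sum_(x <- s | x.2 == pos t) x.1).
rewrite /pqform /pqterms; under [RHS]eq_bigr => t _ do rewrite rmorph_sum mulr_suml.
rewrite (exchange_big_dep predT) //= big_seq [RHS]big_seq; apply: eq_bigr => -[a [i j]] xs.
have ijr : (i + j <= r)%N by rewrite /r (big_rem _ xs) /= leq_maxl.
have [ir jr] : (i < r.+1)%N /\ (j < r.+1)%N.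
  by rewrite !ltnS; split; apply: leq_trans ijr; rewrite ?leq_addr ?leq_addl.
pose t : T r := exist _ (Ordinal ir, Ordinal jr) ijr.
by rewrite (big_pred1 t).
Qed.

Local Notation Xy := (Xinf_in p_pr (ch_y D : Xr D 0)).

Lemma PhiD_y i j : (PhiD i j *: Xy)%LM = Xinf_in p_pr (phi_dq_iter p_pr D i j : Xr D (i + j)).
Proof.
rewrite -lm_scaleA.
have -> : (pqpi D (TDelta A) ^+ j *: Xy)%LM = Xinf_in p_pr (dq_iter D j : Xr D j).
  elim: j => [|j IH]; first by rewrite expr0 lm_scale1.
  by rewrite exprS -lm_scaleA IH Xinf_deltaE.
elim: i => [|i IH]; first by rewrite expr0 lm_scale1.
by rewrite exprS -lm_scaleA IH Xinf_phiE.
Qed.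

Lemma pqform_y r (c : T r -> A) : (pqform c *: Xy)%LM = Xinf_in p_pr (ch_form c).
Proof.
rewrite /pqform /ch_form; elim/big_rec2: _ => [|t f P _ e].
  by rewrite lm_scale0 /Xinf_in /Xlim_in -(dl_zeroE (@ch_upD p A D) r).
rewrite lm_scaleDl e -lm_scaleA PhiD_y.
have -> : Xinf_in p_pr (phi_dq_iter p_pr D (val t).1 (val t).2 : Xr D _) =
    Xinf_in p_pr (phi_dq_y p_pr D r (val t).1 (val t).2).
  by apply: esym; apply: dl_in_trans; apply: (valP t).
by rewrite Xinf_constE; apply: Xlim_addE.
Qed.

(** P - Q is a normal form annihilating y. Vanishing in the direct limit means vanishing at some
    level N, which forces its coefficients to be zero. *)
Lemma pqring_y_inj (hA : padic_complete p A) (P Q : pqR) : (P *: Xy)%LM = (Q *: Xy)%LM -> P = Q.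
Proof.
move=> e; apply/eqP; rewrite -subr_eq0; apply/eqP; have [r [c cE]] := pqform_surj (P - Q).
have : Xinf_in p_pr (ch_form c) = Xinf_in p_pr (lm_zero : Xr D r).
  rewrite -pqform_y -cE; apply: (@lm_addI _ _ (Q *: Xy)%LM).
  rewrite -lm_scaleDl addrC subrK e; apply: esym.
  by rewrite -[X in (_ + X)%LM](dl_zeroE (@ch_upD p A D) r); apply: lm_addr0.
move/dl_inP => [N [rN _ eN]].
have c0 : forall t, c t = 0.
  apply: (jform_eval_inj hA rN) => S hS u.
  rewrite -(ch_transE rN (jform_lev c) (ch_formE c hS u)) eN.
  (* The zero character is evaluation of the zero polynomial, at level r and so at level N. *)
  by rewrite (@ch_transE _ _ _ 0) ?rmorph0 // rpred0.
by rewrite cE /pqform big1 // => t _; rewrite c0 rmorph0 mul0r.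
Qed.

Lemma big_unit (V : Type) (op : V -> V -> V) (idx : V) (F : unit -> V) :
  \big[op/idx]_(i : unit) F i = op (F tt) idx.
Proof.
have -> : index_enum unit = [:: tt]; last by rewrite big_cons big_nil.
apply: perm_small_eq => //; apply: uniq_perm; rewrite ?index_enum_uniq // => -[].
by rewrite mem_index_enum.
Qed.

Lemma Xinf_y_basis (hA : padic_complete p A) : is_basis (fun _ : unit => Xy).
Proof.
move=> x; have [r [f ->]] := Xlim_surj x; have [c ->] := ch_form_surj hA f.
have e P : \big[@lm_add _ (Xinf p_pr D) / lm_zero]_(i : unit) ([ffun _ : unit => P] i *: Xy)%LM
    = (P *: Xy)%LM by rewrite big_unit ffunE lm_addr0.
exists [ffun=> pqform c]; split; first by rewrite e pqform_y.
move=> d; have -> : d = [ffun _ : unit => d tt] by apply/ffunP => -[]; rewrite ffunE.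
rewrite e -[LHS]pqform_y => /(pqring_y_inj hA) ->.
by [].
Qed.

End Jets.

Theorem proposition6p1 (p : nat) (p_pr : prime p) (p_neq2 : p <> 2%N)
    (A : idomainType) (D : pq_structure p A)
    (A_complete : padic_complete p A) (A_noetherian : noetherian A)
    (A_char0 : [pchar A] =i pred0) :
  (forall r : nat,
     is_basis (fun ij : {ij : 'I_r.+1 * 'I_r.+1 | (ij.1 + ij.2 <= r)%N} =>
       phi_dq_y p_pr D r (val ij).1 (val ij).2)) /\
  is_basis (fun _ : unit => Xinf_in p_pr (ch_y D : Xr D 0)).

Proof.
have p_neq0 : p%:R != 0 :> A by have := A_char0 p; rewrite !inE p_pr => /= ->.
split=> [r|]; first exact: phi_dq_y_basis.
exact: Xinf_y_basis.
Qed.
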